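(* Let $L$ be a finite-dimensional dually atomistic Leibniz algebra over a field of characteristic zero. Then $L$ is a three-dimensional non-split simple Lie algebra or $L$ is solvable.
   Context: A (right) Leibniz algebra over a field $F$ is an $F$-vector space $L$ with a bilinear product $[\cdot,\cdot]$ satisfying $[x,[y,z]]=[[x,y],z]-[[x,z],y]$ for all $x,y,z\in L$. $L$ is solvable if $L^{(n)}=0$ for some $n$, where $L^{(0)}=L$, $L^{(k+1)}=[L^{(k)},L^{(k)}]$. $L$ is dually atomistic if every subalgebra of $L$ is an intersection of maximal subalgebras of $L$ (with $L$ itself being the empty intersection). A three-dimensional simple Lie algebra over $F$ (characteristic zero) is non-split if it is not isomorphic to $\mathrm{sl}_2(F)$. *)

(* Defs.v *)
From mathcomp Require Import all_boot all_algebra.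

Set Implicit Arguments.
Unset Strict Implicit.
Unset Printing Implicit Defensive.

Import GRing.Theory.
Local Open Scope ring_scope.

(* A finite-dimensional algebra is a vectType L together with a product br. *)

Definition right_leibniz (F : fieldType) (L : vectType F) (br : L -> L -> L) :=
  forall x y z : L, br x (br y z) = br (br x y) z - br (br x z) y.

Definition is_lie (F : fieldType) (L : vectType F)
    (br : {bilinear L -> L -> L}) :=
  (forall x : L, br x x = 0) /\
  (forall x y z : L, br x (br y z) + br y (br z x) + br z (br x y) = 0).

Definition subalgebra (F : fieldType) (L : vectType F) (br : L -> L -> L)
    (U : {vspace L}) : Prop :=
  {in U &, forall x y, br x y \in U}.

Definition ideal (F : fieldType) (L : vectType F) (br : L -> L -> L)
    (I : {vspace L}) : Prop :=
  forall x y : L, x \in I -> br x y \in I /\ br y x \in I.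

Definition maximal_subalgebra (F : fieldType) (L : vectType F)
    (br : L -> L -> L) (M : {vspace L}) : Prop :=
  [/\ subalgebra br M, M <> fullv
    & forall U : {vspace L},
        subalgebra br U -> (M <= U)%VS -> U = M \/ U = fullv].

(* S is an arbitrary, possibly infinite or empty, family: the empty family    *)
(* yields U = fullv.                                                          *)
Definition dually_atomistic (F : fieldType) (L : vectType F)
    (br : L -> L -> L) : Prop :=
  forall U : {vspace L}, subalgebra br U ->
    exists S : {vspace L} -> Prop,
      (forall M, S M -> maximal_subalgebra br M) /\
      (forall x : L, x \in U <-> (forall M, S M -> x \in M)).

(* For bilinear br this is the span of all br u v with u in U and v in V, as  *)
(* brv_sub states; compare prodv in falgebra.                                 *)
Definition brv (F : fieldType) (L : vectType F) (br : L -> L -> L)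
    (U V : {vspace L}) : {vspace L} :=
  <<allpairs br (vbasis U) (vbasis V)>>%VS.

Lemma brv_sub (F : fieldType) (L : vectType F) (br : {bilinear L -> L -> L})
    (U V W : {vspace L}) :
  (brv br U V <= W)%VS <-> {in U & V, forall u v, br u v \in W}.
Proof.
split=> [/subvP sW u v /coord_vbasis-> /coord_vbasis-> | brW].
  rewrite linear_sumlz; apply: memv_suml => i _ /=.
  rewrite linear_sumr; apply: memv_suml => j _ /=.
  rewrite linearZl_LR linearZr_LR; do 2![apply: memvZ].
  by apply/sW/memv_span/allpairs_f; apply: mem_nth; rewrite size_tuple.
apply/span_subvP => _ /allpairsP[[u v] [Uu Vv ->]].
by apply: brW; apply: vbasis_mem.
Qed.

Definition derived (F : fieldType) (L : vectType F) (br : L -> L -> L)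
    (n : nat) : {vspace L} :=
  iter n (fun U : {vspace L} => brv br U U) fullv.

Definition solvable_algebra (F : fieldType) (L : vectType F)
    (br : L -> L -> L) : Prop :=
  exists n : nat, derived br n = 0%VS.

Definition simple_lie (F : fieldType) (L : vectType F)
    (br : {bilinear L -> L -> L}) : Prop :=
  [/\ is_lie br, exists x y : L, br x y <> 0
    & forall I : {vspace L}, ideal br I -> I = 0%VS \/ I = fullv].

Definition isomorphic_algebras (F : fieldType) (L L' : vectType F)
    (br : L -> L -> L) (br' : L' -> L' -> L') : Prop :=
  exists f : {linear L -> L'},
    bijective f /\ forall x y : L, f (br x y) = br' (f x) (f y).

Definition sl2_vspace (F : fieldType) : {vspace 'M[F]_2} :=
  lker (linfun (mxtrace : 'M[F]_2 -> F^o)).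

Lemma mem_sl2 (F : fieldType) (A : 'M[F]_2) :
  (A \in sl2_vspace F) = (\tr A == 0).
Proof. by rewrite memv_ker lfunE. Qed.

Definition sl2 (F : fieldType) : vectType F := subvs_of (sl2_vspace F).

Lemma commutator_sl2 (F : fieldType) (A B : 'M[F]_2) :
  A *m B - B *m A \in sl2_vspace F.
Proof. by rewrite mem_sl2 linearB /= mxtrace_mulC subrr. Qed.

Definition sl2_br (F : fieldType) (u v : sl2 F) : sl2 F :=
  Subvs (commutator_sl2 (vsval u) (vsval v)).

Definition nonsplit_simple_lie3 (F : fieldType) (L : vectType F)
    (br : {bilinear L -> L -> L}) : Prop :=
  [/\ \dim {:L} = 3%N, simple_lie br
    & ~ isomorphic_algebras br (@sl2_br F)].

(* Main.v *)
From HB Require Import structures.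
Require Import Defs.
From mathcomp Require Import all_boot all_order all_algebra all_field ring.
From Stdlib Require Import Classical.

(** The algebra L is compared with its solvable radical R.  This ideal contains
all squares [x, x], so L / R is a Lie algebra, and it has no nonzero abelian ideal.  If
R = L there is nothing left to prove.

Otherwise let S = L / R.  By the criterion of Cartan
([nondegenerate_of_no_abelian_ideal]) its Killing form kappa is nondegenerate, so S
is perfect and its derivations are inner.  Dual atomism enters through the right
normalizer of a maximal subalgebra M: it is a subalgebra, so it is M or S, and
perfectness excludes S.  Hence if ad y is a polynomial in ad x, then y belongs to every
maximal subalgebra that contains x, and so y is a multiple of x
([quotient_polynomially_closed]).

This forces rank one.  If kappa(x, x) <> 0, the semisimple part of ad x is inner and a
polynomial in ad x, so ad x is diagonalizable over a splitting field.  If x and y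
commute and both are anisotropic, then both ad x and ad y are polynomials in
ad (x + m y) for a suitable integer m, so x and y are proportional.  It follows that
x spans its own centralizer ([anisotropic_centralizer]).  Over a splitting field an
eigenvector of ad x for a suitable root then extends to an sl2-triple around x, and
the weights of its orthogonal complement would include 0 or half of that root; so the
triple spans and dim S = 3 ([anisotropic_dimension]).

The radical vanishes ([radical_eq0]): if R / I is a chief factor, dual atomism makes it
a line, on which L acts trivially because L / R is perfect; the complements of that line
are then too few to cut out the diagonal lines x + j.  So L = S has dimension 3 and no
abelian ideal, which makes it simple, and it is not sl2(F), where the line of a
nilpotent element is not an intersection of maximal subalgebras
([split_not_dually_atomistic]).

The quotient S is realized on row vectors by a multiplication table, so that extending
scalars to a splitting field of one or two operators is entrywise. *)

Set Implicit Arguments.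
Unset Strict Implicit.
Unset Printing Implicit Defensive.

Import Order.TTheory GRing.Theory Num.Theory.
Local Open Scope ring_scope.

(** * Linear predicates *)

(** Subspaces are mostly handled through their membership predicates, so that
no basis has to be chosen; [closed_lin_mx] and [closed_lin_vspace] turn such a
predicate into a matrix or a [{vspace L}] once a dimension argument is due. *)
Definition closed_lin (K : fieldType) (V : lmodType K) (P : V -> Prop) :=
  P 0 /\ forall c u v, P u -> P v -> P (c *: u + v).

Lemma closed_linD (K : fieldType) (V : lmodType K) (P : V -> Prop) u v :
  closed_lin P -> P u -> P v -> P (u + v).
Proof. by case=> _ Plin Pu Pv; rewrite -[u]scale1r; apply: Plin. Qed.

Lemma closed_linZ (K : fieldType) (V : lmodType K) (P : V -> Prop) c u :
  closed_lin P -> P u -> P (c *: u).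
Proof. by case=> P0 Plin Pu; rewrite -[_ *: _]addr0; apply: Plin. Qed.

Lemma closed_linN (K : fieldType) (V : lmodType K) (P : V -> Prop) u :
  closed_lin P -> P u -> P (- u).
Proof. by move=> linP Pu; rewrite -scaleN1r; apply: closed_linZ. Qed.

Lemma closed_lin_delta (F : fieldType) n (P : 'rV[F]_n -> Prop) : closed_lin P ->
  (forall i, P (delta_mx 0 i)) -> forall u, P u.
Proof.
case=> P0 Plin Pd u; rewrite [u]row_sum_delta.
by elim/big_rec: _ => // i w _ Pw; apply: Plin.
Qed.

Lemma submx_closed_lin (F : fieldType) m n (A : 'M[F]_(m, n)) :
  closed_lin (fun v : 'rV_n => (v <= A)%MS).
Proof. by split=> [|c u v uA vA]; rewrite ?sub0mx // addmx_sub ?scalemx_sub. Qed.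

Lemma closed_lin_sub (F : fieldType) m n (A : 'M[F]_(m, n)) P : closed_lin P ->
  (forall i, P (row i A)) -> forall v, (v <= A)%MS -> P v.
Proof.
case=> P0 Plin PA v vA; have [d ->] := submxP vA; rewrite mulmx_sum_row.
by elim/big_rec: _ => // i w _ Pw; apply: Plin.
Qed.

Lemma ex_max_rank (F : fieldType) n (Pr : 'M[F]_n -> Prop) A0 : Pr A0 ->
  exists2 A, Pr A & forall A', Pr A' -> (\rank A' <= \rank A)%N.
Proof.
suff: forall k A, Pr A -> (n - \rank A < k)%N ->
    exists2 A, Pr A & forall A', Pr A' -> (\rank A' <= \rank A)%N.
  by move=> ex PrA; apply: (ex (n - \rank A0).+1 A0).
elim=> // k IHk A PrA ltk; case: (classic (exists2 A', Pr A' & (\rank A < \rank A')%N)).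
  case=> A' PrA' ltA; apply: (IHk A') => //; rewrite -ltnS; apply: leq_trans ltk.
  by rewrite ltnS ltn_sub2l // (leq_trans ltA) ?rank_leq_row.
by move=> nlt; exists A => // A' PrA'; rewrite leqNgt; apply/negP => ltA; case: nlt; exists A'.
Qed.

Lemma closed_lin_mx (F : fieldType) n (P : 'rV[F]_n -> Prop) : closed_lin P ->
  exists A : 'M[F]_n, forall v, (v <= A)%MS <-> P v.
Proof.
move=> linP; pose Pr (A : 'M_n) := forall v, (v <= A)%MS -> P v.
have [|A PA maxA] := @ex_max_rank _ _ Pr 0.
  by move=> v; rewrite submx0 => /eqP->; case: linP.
exists A => v; split=> [/PA // | Pv]; apply: contraT => vA.
have: Pr (A + v)%MS.
  move=> w; rewrite addsmxE; apply: closed_lin_sub => // i.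
  case: (splitP i) => j Dj.
    by rewrite (_ : i = lshift 1 j) ?rowKu; [apply: PA; rewrite row_sub | apply: val_inj].
  rewrite (_ : i = rshift n j) ?rowKd; last exact: val_inj.
  by rewrite rowE ord1 (_ : delta_mx 0 0 = 1%:M) ?mul1mx //; apply/rowP=> x; rewrite !mxE !ord1.
move/maxA; rewrite leqNgt => /negP[]; apply: rank_ltmx.
rewrite ltmxE addsmxSl addsmx_sub submx_refl /=.
by rewrite (negPf vA).
Qed.

Lemma ex_max_dim (F : fieldType) (L : vectType F) (Pr : {vspace L} -> Prop) U0 :
  Pr U0 -> exists2 U, Pr U & forall U', Pr U' -> (\dim U' <= \dim U)%N.
Proof.
suff: forall k U, Pr U -> (\dim {:L} - \dim U < k)%N ->
    exists2 U, Pr U & forall U', Pr U' -> (\dim U' <= \dim U)%N.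
  by move=> ex PrU; apply: (ex (\dim {:L} - \dim U0).+1 U0).
elim=> // k IHk U PrU ltk; case: (classic (exists2 U', Pr U' & (\dim U < \dim U')%N)).
  case=> U' PrU' ltU; apply: (IHk U') => //; rewrite -ltnS; apply: leq_trans ltk.
  by rewrite ltnS ltn_sub2l // (leq_trans ltU) ?dimvS ?subvf.
by move=> nlt; exists U => // U' PrU'; rewrite leqNgt; apply/negP => ltU; case: nlt; exists U'.
Qed.

Lemma closed_lin_vspace (F : fieldType) (L : vectType F) (P : L -> Prop) :
  closed_lin P -> exists U : {vspace L}, forall x, x \in U <-> P x.
Proof.
case=> P0 Plin; pose Pr (U : {vspace L}) := forall x, x \in U -> P x.
have [|U PU maxU] := @ex_max_dim _ _ Pr 0%VS; first by move=> x; rewrite memv0 => /eqP->.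
exists U => x; split=> [/PU // | Px]; apply: contraT => xU.
have: Pr (U + <[x]>)%VS.
  by move=> _ /memv_addP[u uU [_ /vlineP[c ->] ->]]; rewrite addrC; apply: Plin => //; apply: PU.
move/maxU => le_dim; have /eqP E : U == (U + <[x]>)%VS.
  by rewrite eqEdim addvSl.
by rewrite E (subvP (addvSr _ _)) ?memv_line in xU.
Qed.

Lemma vspace_closed_lin (F : fieldType) (L : vectType F) (U : {vspace L}) :
  closed_lin (fun x => x \in U).
Proof. by split=> [|c x y xU yU]; rewrite ?mem0v // rpredD ?rpredZ. Qed.

(** * Splitting fields, Chinese remainders and traces *)

Lemma irreducible_factor (F : fieldType) (p : {poly F}) :
  (1 < size p)%N -> exists2 q, irreducible_poly q & q %| p.
Proof.
have [m] := ubnP (size p); elim: m => // m IHm in p *; rewrite ltnS => le_pm p_gt1.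
case: (classic (irreducible_poly p)) => [irr_p | red_p]; first by exists p.
have [q [q_neq1 q_dv_p q_np]] :
    exists q : {poly F}, [/\ size q != 1%N, q %| p & ~~ (q %= p)].
  apply: NNPP => noq; apply: red_p; split=> // q q1 qp; apply: contraT => qnp.
  by case: noq; exists q.
have p0 : p != 0 by rewrite -size_poly_gt0 (ltn_trans _ p_gt1).
have q0 : q != 0 by apply: contraTneq q_dv_p => ->; rewrite dvd0p.
have q_gt1 : (1 < size q)%N by rewrite ltn_neqAle eq_sym q_neq1 size_poly_gt0.
have lt_qp : (size q < size p)%N.
  by rewrite ltn_neqAle dvdp_leq // andbT dvdp_size_eqp.
have [r irr_r rq] := IHm q (leq_trans lt_qp le_pm) q_gt1.
by exists r => //; apply: dvdp_trans q_dv_p.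
Qed.

(** Adjoin a root of an irreducible factor, divide the root out, repeat. *)
Lemma splitting_extension (F : fieldType) (p : {poly F}) : p != 0 ->
  exists (K : fieldType) (f : {rmorphism F -> K}) (s : seq K),
    map_poly f p %= \prod_(z <- s) ('X - z%:P).
Proof.
have [m] := ubnP (size p); elim: m => // m IHm in F p *; rewrite ltnS => le_pm p0.
have [p_le1 | p_gt1] := leqP (size p) 1.
  exists F, idfun, [::]; rewrite big_nil map_poly_id // -size_poly_eq1.
  by rewrite eqn_leq p_le1 size_poly_gt0.
have [q irr_q q_dv_p] := irreducible_factor p_gt1.
have [L _ [z qz0 _]] := irredp_FAdjoin irr_q.
have pz0 : root (map_poly (in_alg L) p) z.
  move: qz0; rewrite -!dvdp_XsubCl => /dvdp_trans-> //.
  by rewrite dvdp_map.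
have [p1 Dp] := factor_theorem _ _ pz0.
have p10 : p1 != 0.
  by apply: contraTneq p0 => p10; rewrite -(map_poly_eq0 (in_alg L)) Dp p10 mul0r eqxx.
have lt_p1m : (size p1 < m)%N.
  rewrite (leq_trans _ le_pm) // -(size_map_poly (in_alg L)) Dp.
  by rewrite size_Mmonic ?monicXsubC // size_XsubC addn2.
have [K [g [s Dp1]]] := IHm L p1 lt_p1m p10.
exists K, (g \o in_alg L), (g z :: s).
by rewrite map_poly_comp /= Dp rmorphM /= map_polyXsubC big_cons mulrC eqp_mul2l
  ?polyXsubC_eq0.
Qed.

Lemma coprimep_XsubC_exp_prod (K : fieldType) (s : seq K) a M N : a \notin s ->
  coprimep (('X - a%:P) ^+ M) (\prod_(b <- s) ('X - b%:P) ^+ N).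
Proof.
elim: s => [|b s IHs] /=; first by rewrite big_nil coprimep1.
rewrite inE negb_or big_cons coprimepMr => /andP[ab s'a]; rewrite IHs // andbT.
by rewrite coprimep_expl // coprimep_expr // coprimep_XsubC2 // subr_eq0 eq_sym.
Qed.

(** Evaluated at an operator, the polynomial q acts on the generalized eigenspace
of every a in s as the scalar [phi a]: this is how semisimple parts and their
variants are obtained as polynomials in the operator. *)
Lemma crt_poly (K : fieldType) (s : seq K) (N : nat) (phi : K -> K) : uniq s ->
  exists q : {poly K}, forall a, a \in s -> ('X - a%:P) ^+ N %| q - (phi a)%:P.
Proof.
elim: s => [|a s IHs] /= => [_ | /andP[s'a Us]]; first by exists 0.
have [q q_phi] := IHs Us; set P := \prod_(b <- s) ('X - b%:P) ^+ N.
have co_aP : coprimep (('X - a%:P) ^+ N) P by apply: coprimep_XsubC_exp_prod.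
have [[u v] /= Duv] := Bezout_eq1_coprimepP _ _ co_aP.
exists (q + v * P * ((phi a)%:P - q)) => b; rewrite inE => /predU1P[-> | sb].
  have -> : v * P = 1 - u * ('X - a%:P) ^+ N by rewrite -Duv addrC addKr.
  set Q := _ ^+ N; rewrite (_ : _ - _%:P = - (u * ((phi a)%:P - q)) * Q); last by ring.
  exact: dvdp_mulIr.
rewrite addrAC dvdp_addr ?q_phi // dvdp_mulr // dvdp_mull //.
by rewrite /P (big_rem b) //= dvdp_mulr.
Qed.

(** [X^m = X^m - A^m] is a multiple of [X - A], so on taking determinants the
characteristic polynomial of A divides a power of X; the trace is one of its
lower coefficients. *)
Lemma mxtrace_nilpotent (K : fieldType) n (A : 'M[K]_n.+1) m :
  A ^+ m = 0 -> \tr A = 0.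
Proof.
move=> Am0; have DX: char_poly A %| 'X^(m * n.+1).
  have: ('X%:M : 'M[{poly K}]_n.+1) ^+ m - (map_mx polyC A) ^+ m = ('X ^+ m)%:M.
    by rewrite -!rmorphXn /= Am0 rmorph0 subr0.
  rewrite subrXX_comm; last exact: comm_scalar_mx.
  move/(congr1 determinant); rewrite det_mulmx det_scalar -exprM => <-.
  exact: dvdp_mulIl.
have [k _ Dk] : exists2 k, (k <= m * n.+1)%N & char_poly A %= 'X^k.
  move: DX; rewrite -['X]subr0; case/dvdp_exp_XsubCP=> k le_k Dk.
  by exists k.
have {}Dk: char_poly A = 'X^k.
  by apply/eqP; rewrite -eqp_monic ?char_poly_monic ?monicXn.
have Ek: k = n.+1 by apply: succn_inj; rewrite -(size_char_poly A) Dk size_polyXn.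
have := char_poly_trace A isT; rewrite Dk Ek coefXn ltn_eqF //.
by move/esym/eqP; rewrite oppr_eq0 => /eqP.
Qed.

(** The rank factorization E = C R of an idempotent satisfies R C = 1. *)
Lemma mxtrace_idempotent (K : fieldType) n (E : 'M[K]_n) :
  E *m E = E -> \tr E = (\rank E)%:R.
Proof.
move=> EE; have := mulmx_base E; set C := col_base E; set R := row_base E => DE.
suff RC : R *m C = 1%:M by rewrite -{1}DE mxtrace_mulC RC mxtrace1.
have Cinj := @row_full_inj _ _ _ (\rank E) C (col_base_full E).
have Rinj := @row_free_inj _ n _ _ R (row_base_free E).
by apply: Cinj; apply: Rinj; rewrite /= mulmx1 mulmxA DE -mulmxA DE EE.
Qed.

(** * Spectral theory of one operator *)

Lemma prod_XsubC_exp_dvdp (K : fieldType) (s : seq K) N (p : {poly K}) : uniq s ->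
    (forall a, a \in s -> ('X - a%:P) ^+ N %| p) ->
  \prod_(a <- s) ('X - a%:P) ^+ N %| p.
Proof.
elim: s => [|a s IHs] /= => [_ _ | /andP[s'a Us] dv_p]; first by rewrite big_nil dvd1p.
rewrite big_cons Gauss_dvdp; last exact: coprimep_XsubC_exp_prod.
by rewrite dv_p ?mem_head // IHs // => b sb; rewrite dv_p // inE sb orbT.
Qed.

(** X has all its eigenvalues in the ground field, and s lists them; the exponent
[n.+1] is large enough for every generalized eigenspace. *)
Definition spectrum (K : fieldType) n (X : 'M[K]_n.+1) (s : seq K) :=
  [/\ uniq s, forall a, a \in s -> eigenvalue X a
    & horner_mx X (\prod_(a <- s) ('X - a%:P) ^+ n.+1) = 0].

Lemma spectrum_extension (F : fieldType) n (X : 'M[F]_n.+1) :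
  exists (K : fieldType) (f : {rmorphism F -> K}) (s : seq K),
    spectrum (map_mx f X) s.
Proof.
have Xn0 : char_poly X != 0 by rewrite monic_neq0 ?char_poly_monic.
have [K [f [t Dt]]] := splitting_extension Xn0; rewrite map_char_poly in Dt.
exists K, f, (undup t); split; first exact: undup_uniq.
  move=> a; rewrite mem_undup => ta; rewrite eigenvalue_root_char.
  by rewrite (eqp_root Dt) root_prod_XsubC.
have sz_t : size t = n.+1.
  have := eqp_size Dt; rewrite size_char_poly size_prod_XsubC.
  by move/succn_inj.
apply/mxminpoly_minP; apply: dvdp_trans (mxminpoly_dvd_char _) _.
rewrite (eqp_dvdl _ Dt) -{}sz_t.
have: forall r : seq K, {subset r <= t} ->
    \prod_(z <- r) ('X - z%:P) %| \prod_(a <- undup t) ('X - a%:P) ^+ size r.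
  elim=> [|z r IHr] sub_rt; first by rewrite big_nil dvd1p.
  have tz : z \in undup t by rewrite mem_undup sub_rt ?mem_head.
  under [X in _ %| X]eq_bigr do rewrite exprS.
  rewrite big_cons big_split /= dvdp_mul ?IHr //; last first.
    by move=> y ry; rewrite sub_rt // inE ry orbT.
  by rewrite (big_rem z) //= dvdp_mulIl.
exact.
Qed.

Lemma spectrum_map (F K : fieldType) (f : {rmorphism F -> K}) n (X : 'M[F]_n.+1) s :
  spectrum X s -> spectrum (map_mx f X) (map f s).
Proof.
case=> Us eig_s X0; split; first by rewrite map_inj_uniq //; apply: fmorph_inj.
  by move=> _ /mapP[a sa ->]; rewrite eigenvalue_map eig_s.
have -> : \prod_(a <- map f s) ('X - a%:P) ^+ n.+1
        = map_poly f (\prod_(a <- s) ('X - a%:P) ^+ n.+1).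
  by rewrite rmorph_prod big_map; apply: eq_bigr => a _; rewrite rmorphXn /= map_polyXsubC.
by rewrite -map_horner_mx X0 map_mx0.
Qed.

Section Spectrum.
Variables (K : fieldType) (n : nat) (X : 'M[K]_n.+1) (s : seq K).
Hypothesis specX : spectrum X s.
Implicit Types (p q : {poly K}) (v w : 'rV[K]_n.+1).

Lemma horner_mx_mul p q : horner_mx X (p * q) = horner_mx X p *m horner_mx X q.
Proof. exact: rmorphM. Qed.

Lemma horner_mx_dvd v p q : p %| q ->
  v *m horner_mx X p = 0 -> v *m horner_mx X q = 0.
Proof.
by case/dvdpP=> r -> vp0; rewrite mulrC rmorphM /= mulmxA vp0 mul0mx.
Qed.

Lemma coprime_annihilator v p q : coprimep p q ->
  v *m horner_mx X p = 0 -> v *m horner_mx X q = 0 -> v = 0.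
Proof.
move=> /Bezout_eq1_coprimepP[[a b] /= ab1] vp0 vq0.
rewrite -[v]mulmx1 -[1%:M](rmorph1 (horner_mx X)) -ab1 rmorphD /= mulmxDr.
by rewrite (horner_mx_dvd _ vp0) ?(horner_mx_dvd _ vq0) ?addr0 // dvdp_mulIr.
Qed.

(** The generalized eigenspaces span: a Bezout relation between the factors of
the polynomial that kills X splits every vector.  In the form of an induction
principle the splitting never has to be named. *)
Lemma weight_ind (P : 'rV[K]_n.+1 -> Prop) : closed_lin P ->
    (forall a v, a \in s -> v *m horner_mx X (('X - a%:P) ^+ n.+1) = 0 -> P v) ->
  forall v, P v.
Proof.
case=> P0 Plin Pw v; case: specX => Us _ X0.
have {X0}: v *m horner_mx X (\prod_(a <- s) ('X - a%:P) ^+ n.+1) = 0.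
  by rewrite X0 mulmx0.
elim: (s) Us Pw v => [|a t IHt] /= => [_ _ v|/andP[t'a Ut] Pw v].
  by rewrite big_nil rmorph1 mulmx1 => ->.
rewrite big_cons; set p := _ ^+ _; set q := \prod_(b <- _) _ => v0.
have co_pq : coprimep p q by apply: coprimep_XsubC_exp_prod.
have [[c d] /= cd1] := Bezout_eq1_coprimepP _ _ co_pq.
rewrite -[v]mulmx1 -[1%:M](rmorph1 (horner_mx X)) -cd1 rmorphD /= mulmxDr -[_ *m _]scale1r.
apply: Plin.
  apply: IHt => // [b w tb|]; first by apply: Pw; rewrite inE tb orbT.
  rewrite -mulmxA -horner_mx_mul; apply: horner_mx_dvd v0.
  by rewrite -mulrA dvdp_mulIr.
apply: (Pw a); first exact: mem_head.
rewrite -mulmxA -horner_mx_mul; apply: horner_mx_dvd v0.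
by rewrite -mulrA [q * p]mulrC dvdp_mulIr.
Qed.

(** The multiplicity [r a] is the rank of the spectral idempotent e_a(X), where
e_a is 1 modulo a power of X - a and 0 modulo the powers for the other eigenvalues;
the difference between p(X)
and the combination of the e_a(X) with coefficients p(a) is nilpotent. *)
Lemma trace_horner : exists r : K -> nat, (forall a, a \in s -> (0 < r a)%N) /\
  forall p, \tr (horner_mx X p) = \sum_(a <- s) p.[a] *+ r a.
Proof.
case: specX => Us eigs X0.
have kill p : (forall a, a \in s -> ('X - a%:P) ^+ n.+1 %| p) -> horner_mx X p = 0.
  move=> dv_p; have /dvdpP[c ->] := prod_XsubC_exp_dvdp Us dv_p.
  by rewrite rmorphM /= X0 mulr0.
have exE a : exists e : {poly K}, forall b, b \in s ->
    ('X - b%:P) ^+ n.+1 %| e - (b == a)%:R%:P.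
  exact: (crt_poly _ (fun b => (b == a)%:R) Us).
pose good (e : K -> {poly K}) (t : seq K) := forall a, a \in t -> forall b, b \in s ->
    ('X - b%:P) ^+ n.+1 %| e a - (b == a)%:R%:P.
have [e De] : exists e, good e s.
  elim: (s) Us => [|a t IHt] /= => [_|/andP[t'a Ut]]; first by exists (fun=> 0).
  have [e De] := IHt Ut; have [ea Dea] := exE a.
  exists (fun b => if b == a then ea else e b) => b; rewrite inE.
  by case: (eqVneq b a) => [-> _ | _ /= tb] c sc; [apply: Dea | apply: De].
have e_at a b : a \in s -> b \in s -> (e a).[b] = (b == a)%:R.
  move=> sa sb; apply/eqP; rewrite -subr_eq0.
  have : 'X - b%:P %| e a - (b == a)%:R%:P.
    by apply: dvdp_trans (De a sa b sb); rewrite dvdp_exp.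
  by rewrite dvdp_XsubCl rootE hornerD hornerN hornerC.
pose E a := horner_mx X (e a).
have EE a : a \in s -> E a *m E a = E a.
  move=> sa; apply/eqP; rewrite -subr_eq0 -horner_mx_mul -rmorphB /=.
  apply/eqP/kill => b sb; have := De a sa b sb.
  have -> : e a * e a - e a = e a * (e a - 1) by ring.
  have [_|_] := eqVneq b a.
    exact: dvdp_mull.
  by rewrite subr0; apply: dvdp_mulr.
exists (fun a => \rank (E a)); split=> [a sa | p].
  rewrite lt0n mxrank_eq0; have /eigenvalueP[v vX v0] := eigs a sa.
  apply: contraNneq v0 => Ea0; apply/eqP.
  have: v *m horner_mx X (e a - 1) = 0.
    have: ('X - a%:P) ^+ n.+1 %| e a - 1 by have := De a sa a sa; rewrite eqxx.
    move/horner_mx_dvd; apply.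
    rewrite exprS horner_mx_mul rmorphB /= horner_mx_X horner_mx_C mulmxA mulmxBr vX.
    by rewrite mul_mx_scalar subrr mul0mx.
  rewrite rmorphB rmorph1 /= mulmxBr -/(E a) Ea0 mulmx0 mulmx1 sub0r.
  by move/eqP; rewrite oppr_eq0 => /eqP.
pose g := p - \sum_(a <- s) p.[a] *: e a.
have g0 : horner_mx X g ^+ n.+1 = 0.
  rewrite -rmorphXn; apply: kill => b sb; rewrite dvdp_exp2r // dvdp_XsubCl rootE.
  rewrite hornerD hornerN horner_sum (big_rem b) //= hornerZ e_at // eqxx mulr1.
  rewrite big_seq_cond big1 ?addr0 ?subrr // => a; rewrite andbT mem_rem_uniq // inE.
  by case/andP=> ab sa; rewrite hornerZ e_at // eq_sym (negPf ab) mulr0.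
have Dp : p = g + \sum_(a <- s) p.[a] *: e a by rewrite subrK.
rewrite {1}Dp rmorphD linearD /= (mxtrace_nilpotent g0) add0r rmorph_sum linear_sum /=.
rewrite !big_seq; apply: eq_bigr => a sa.
by rewrite linearZ /= linearZ /= mxtrace_idempotent ?EE // mulr_natr.
Qed.

End Spectrum.

(** * Lie algebras given by a multiplication table *)

(** A finite-dimensional algebra with a chosen basis is its multiplication table B:
elements are row vectors and the bracket [u, v] is [u *m ad B v].  Extension of
scalars along f : F -> K is then literally [map_mx f B]. *)
Definition ad (K : fieldType) n (B : 'M[K]_(n, n * n)) (v : 'rV[K]_n) : 'M[K]_n :=
  vec_mx (v *m B).

Lemma ad_is_linear (K : fieldType) n (B : 'M[K]_(n, n * n)) : linear (ad B).
Proof. by move=> a u v; rewrite /ad mulmxDl -scalemxAl linearP. Qed.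

HB.instance Definition _ (K : fieldType) n (B : 'M[K]_(n, n * n)) :=
  GRing.isLinear.Build K 'rV[K]_n 'M[K]_n *:%R (ad B) (ad_is_linear B).

(** Antisymmetry rather than [u, u] = 0: both identities are linear in each
argument, hence inherited by extensions of scalars.  The second one says that
[ad] is a homomorphism, which is the Jacobi identity. *)
Definition lie_table (K : fieldType) n (B : 'M[K]_(n, n * n)) :=
  (forall u v : 'rV_n, u *m ad B v = - (v *m ad B u)) /\
  (forall u v : 'rV_n, ad B (u *m ad B v) = ad B u *m ad B v - ad B v *m ad B u).

Definition killing (K : fieldType) n (B : 'M[K]_(n, n * n)) u v : K :=
  \tr (ad B u *m ad B v).

Definition nondegenerate (K : fieldType) n (B : 'M[K]_(n, n * n)) :=
  forall u, (forall v, killing B u v = 0) -> u = 0.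

Definition derivation (K : fieldType) n (B : 'M[K]_(n, n * n)) (D : 'M[K]_n) :=
  forall u v : 'rV_n, (u *m ad B v) *m D = (u *m D) *m ad B v + u *m ad B (v *m D).

Section BaseChange.
Variables (F K : fieldType) (f : {rmorphism F -> K}) (n : nat) (B : 'M[F]_(n, n * n)).
Local Notation "A ^f" := (map_mx f A) : ring_scope.

Lemma map_ad v : (ad B v)^f = ad B^f v^f.
Proof. by rewrite /ad map_vec_mx map_mxM. Qed.

Lemma closed_lin_base_change (P : 'rV[K]_n -> Prop) : closed_lin P ->
  (forall u : 'rV[F]_n, P u^f) -> forall u, P u.
Proof.
by move=> linP Pf; apply: closed_lin_delta => // i; rewrite -(map_delta_mx f).
Qed.

Lemma lie_table_map : lie_table B -> lie_table B^f.
Proof.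
case=> alt jac; split.
  move=> u v; move: u; apply: closed_lin_base_change => [|u].
    split=> [|c u w Pu Pw]; first by rewrite mul0mx linear0 mulmx0 oppr0.
    by rewrite mulmxDl -scalemxAl Pu Pw linearP mulmxDr -scalemxAr opprD scalerN.
  move: v; apply: closed_lin_base_change => [|v].
    split=> [|c v w Pv Pw]; first by rewrite mul0mx linear0 mulmx0 oppr0.
    by rewrite mulmxDl -scalemxAl opprD -scalerN -Pv -Pw linearP mulmxDr -scalemxAr.
  by rewrite -!map_ad -!map_mxM alt map_mxN.
move=> u v; move: u; apply: closed_lin_base_change => [|u].
  split=> [|c u w Pu Pw]; first by rewrite mul0mx !linear0 mul0mx addr0.
  rewrite mulmxDl -scalemxAl !ad_is_linear Pu Pw mulmxDl mulmxDr -scalemxAl -scalemxAr.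
  by rewrite scalerBr opprD [LHS]addrACA.
move: v; apply: closed_lin_base_change => [|v].
  split=> [|c v w Pv Pw]; first by rewrite !linear0 mul0mx ?mulmx0 ?oppr0 ?subr0 ?addr0.
  rewrite ad_is_linear mulmxDr -scalemxAr ad_is_linear Pv Pw mulmxDl mulmxDr -scalemxAl -scalemxAr.
  by rewrite scalerBr opprD [LHS]addrACA.
by rewrite -!map_ad -!map_mxM -map_ad jac map_mxB !map_mxM.
Qed.

End BaseChange.

Section Gram.
Variables (K : fieldType) (n : nat) (B : 'M[K]_(n, n * n)).

Definition gram : 'M[K]_n :=
  \matrix_(i, j) killing B (delta_mx 0 i) (delta_mx 0 j).

Lemma killing_linearl v : scalar (killing B ^~ v).
Proof. by move=> c u w; rewrite /killing linearP mulmxDl -scalemxAl linearP. Qed.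

Lemma killingC u v : killing B u v = killing B v u.
Proof. exact: mxtrace_mulC. Qed.

Lemma killing_linearr u : scalar (killing B u).
Proof. by move=> c v w; rewrite ![killing B u _]killingC killing_linearl. Qed.

Lemma killingDl u w v : killing B (u + w) v = killing B u v + killing B w v.
Proof. by rewrite -[u]scale1r killing_linearl mul1r scale1r. Qed.
Lemma killing0l v : killing B 0 v = 0.
Proof. by rewrite /killing linear0 mul0mx linear0. Qed.
Lemma killingZl c u v : killing B (c *: u) v = c * killing B u v.
Proof. by rewrite -[_ *: _]addr0 killing_linearl killing0l addr0. Qed.
Lemma killingDr u v w : killing B u (v + w) = killing B u v + killing B u w.
Proof. by rewrite ![killing B u _]killingC killingDl. Qed.
Lemma killingZr u c v : killing B u (c *: v) = c * killing B u v.
Proof. by rewrite ![killing B u _]killingC killingZl. Qed.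
Lemma killing0r u : killing B u 0 = 0.
Proof. by rewrite killingC killing0l. Qed.

Lemma closed_lin_killingr u : closed_lin (fun v => killing B u v = 0).
Proof.
split=> [|c v w v0 w0]; first exact: killing0r.
by rewrite killing_linearr v0 w0 mulr0 addr0.
Qed.

Lemma killing_gram u v : killing B u v = (u *m gram *m v^T) 0 0.
Proof.
rewrite mxE /killing {1}(row_sum_delta v) linear_sum mulmx_sumr linear_sum.
apply: eq_bigr => j _; rewrite /= linearZ /= -scalemxAr linearZ /= !mxE mulrC.
congr (_ * _); rewrite {1}(row_sum_delta u) linear_sum mulmx_suml linear_sum.
by apply: eq_bigr => i _; rewrite /= linearZ /= -scalemxAl linearZ /= !mxE.
Qed.

Lemma nondegenerate_gram : nondegenerate B <-> gram \in unitmx.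
Proof.
split=> [ndB | unitG u u0].
  rewrite -row_free_unit -kermx_eq0; apply/eqP/row_matrixP => i; rewrite row0.
  apply: ndB => v; rewrite killing_gram.
  by rewrite -row_mul mulmx_ker row0 mul0mx mxE.
apply: (can_inj (mulmxK unitG)) => /=; rewrite mul0mx; apply/rowP => j.
have := u0 (delta_mx 0 j); rewrite killing_gram trmx_delta -colE mxE => ->.
by rewrite mxE.
Qed.

End Gram.

Lemma nondegenerate_map (F K : fieldType) (f : {rmorphism F -> K}) n
    (B : 'M[F]_(n, n * n)) : nondegenerate B -> nondegenerate (map_mx f B).
Proof.
rewrite !nondegenerate_gram => unitG; suff -> : gram (map_mx f B) = map_mx f (gram B).
  by rewrite map_unitmx.
apply/matrixP=> i j; rewrite !mxE /killing -!(map_delta_mx f) -!map_ad -map_mxM.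
by rewrite -trace_map_mx.
Qed.

Section LieTable.
Variables (K : fieldType) (n : nat) (B : 'M[K]_(n, n * n)).
Hypothesis lieB : lie_table B.

Lemma killing_invariant u v w :
  killing B (u *m ad B v) w = killing B u (v *m ad B w).
Proof.
case: lieB => _ jac; rewrite /killing !jac mulmxBl mulmxBr !linearB /= !mulmxA.
by congr (_ - _); rewrite [RHS]mxtrace_mulC mulmxA.
Qed.

Lemma derivation_ad x : derivation B (ad B x).
Proof.
case: lieB => alt jac u v; rewrite jac mulmxBr !mulmxA.
by rewrite addrC subrK.
Qed.

Lemma derivation_adE D v : derivation B D ->
  ad B (v *m D) = ad B v *m D - D *m ad B v.
Proof.
move=> derD; apply/row_matrixP=> i; rewrite !rowE mulmxBr !mulmxA derD.
by rewrite addrC addKr.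
Qed.

(** The form v |-> tr (ad v D) is kappa(-, z) for some z, so E = D - ad z is a
derivation with tr (ad v E) = 0 for all v.  Then kappa(v E, w) is the trace of
E against the ad of a bracket, which vanishes, and E = 0. *)
Lemma derivation_inner D : nondegenerate B -> derivation B D ->
  exists z, D = ad B z.
Proof.
move=> ndB derD; have := ndB; rewrite nondegenerate_gram => unitG.
pose c : 'cV[K]_n := \col_i \tr (ad B (delta_mx 0 i) *m D).
pose z := c^T *m invmx (gram B).
have Dz v : killing B v z = \tr (ad B v *m D).
  rewrite killingC killing_gram mulmxKV // -trmx_mul mxE.
  rewrite [in RHS](row_sum_delta v) linear_sum mulmx_suml linear_sum mxE.
  by apply: eq_bigr => i _; rewrite linearZ /= -scalemxAl linearZ /= mxE.
exists z; apply/eqP; rewrite -subr_eq0; set E := D - ad B z.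
have derE : derivation B E.
  move=> u v; rewrite /E !mulmxBr derD derivation_ad opprD linearB mulmxBl mulmxBr.
  by rewrite addrACA.
have trE v : \tr (ad B v *m E) = 0.
  by rewrite /E mulmxBr linearB /= -Dz subrr.
apply/eqP/row_matrixP=> i; rewrite row0 rowE; apply: ndB => w.
rewrite /killing derivation_adE // mulmxBl linearB /= -!mulmxA.
have -> : \tr (ad B 'e_i *m (E *m ad B w)) = \tr (ad B w *m ad B 'e_i *m E).
  by rewrite mulmxA [LHS]mxtrace_mulC !mulmxA.
rewrite [X in _ - X]mxtrace_mulC -linearB /= -mulmxBl.
by case: lieB => _ jac; rewrite -jac trE.
Qed.

(** The Leibniz rule in the form
[u, v] (D - (a + b)) = [u (D - a), v] + [u, v (D - b)]. *)
Lemma derivation_bracket_weight D a b i j (u v : 'rV[K]_n) : derivation B D ->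
    iter i (fun w => w *m (D - a%:M)) u = 0 ->
    iter j (fun w => w *m (D - b%:M)) v = 0 ->
  iter (i + j) (fun w => w *m (D - (a + b)%:M)) (u *m ad B v) = 0.
Proof.
move=> derD; have [m] := ubnP (i + j); elim: m => // m IHm in i j u v *.
rewrite ltnS => le_m u0 v0.
have it0 c k : iter k (fun w => w *m (D - c%:M)) (0 : 'rV[K]_n) = 0.
  by elim: k => //= k ->; rewrite mul0mx.
have itD c k (w1 w2 : 'rV[K]_n) : iter k (fun w => w *m (D - c%:M)) (w1 + w2) =
    iter k (fun w => w *m (D - c%:M)) w1 + iter k (fun w => w *m (D - c%:M)) w2.
  by elim: k => //= k ->; rewrite mulmxDl.
case: i => [|i] in le_m u0 *; first by rewrite (u0 : u = 0) mul0mx it0.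
case: j => [|j] in le_m v0 *; first by rewrite (v0 : v = 0) linear0 mulmx0 it0.
rewrite addSn iterSr.
have -> : u *m ad B v *m (D - (a + b)%:M) =
    (u *m (D - a%:M)) *m ad B v + u *m ad B (v *m (D - b%:M)).
  rewrite !mulmxBr derD !mul_mx_scalar mulmxBl linearB /= mulmxBr.
  by rewrite [ad B (b *: v)]linearZ /= -scalemxAl -scalemxAr ?scalerN scalerDl opprD addrACA.
rewrite itD IHm ?add0r -?iterSr //; first by rewrite -addSnnS IHm -?iterSr // addSnnS.
Qed.

End LieTable.

(** * Replicas and additive relations among eigenvalues *)

Lemma iter_horner_mx (K : fieldType) n (D : 'M[K]_n.+1) a k (v : 'rV_n.+1) :
  iter k (fun w => w *m (D - a%:M)) v = v *m horner_mx D (('X - a%:P) ^+ k).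
Proof.
elim: k => [|k IHk] /=; first by rewrite rmorph1 mulmx1.
by rewrite IHk exprSr horner_mx_mul rmorphB /= horner_mx_X horner_mx_C mulmxA.
Qed.

Lemma horner_mx_congr (K : fieldType) n (X : 'M[K]_n.+1) (v : 'rV_n.+1) p q c :
  v *m horner_mx X p = 0 -> p %| q - c%:P -> v *m horner_mx X q = c *: v.
Proof.
move=> vp0 /horner_mx_dvd/(_ vp0)/eqP.
by rewrite rmorphB /= horner_mx_C mulmxBr mul_mx_scalar subr_eq0 => /eqP.
Qed.

Section Replica.
Variables (K : fieldType) (n : nat) (B : 'M[K]_(n.+1, n.+1 * n.+1)).

(** On the generalized eigenspace for a the operator q(D) is the scalar [phi a],
and the bracket of the spaces for a and b lies in the one for a + b, so the
additivity of phi on the spectrum is what makes q(D) a derivation.  A bracket is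
only known to be killed by the exponent [n.+1 + n.+1], hence the congruences. *)
Lemma replica_derivation (D : 'M[K]_n.+1) s (phi : K -> K) q :
    derivation B D -> spectrum D s ->
    (forall a b, a \in s -> b \in s -> a + b \in s -> phi (a + b) = phi a + phi b) ->
    (forall a, a \in s -> ('X - a%:P) ^+ (n.+1 + n.+1) %| q - (phi a)%:P) ->
  derivation B (horner_mx D q).
Proof.
move=> derD specD phiD q_phi u v; set Q := horner_mx D q; move: u.
have q_at a (w : 'rV_n.+1) : a \in s ->
    w *m horner_mx D (('X - a%:P) ^+ n.+1) = 0 -> w *m Q = phi a *: w.
  move=> sa wa0; rewrite /Q; apply: horner_mx_congr wa0 _.
  by apply: dvdp_trans (q_phi a sa); rewrite dvdp_exp2l // leq_addr.
apply: (weight_ind specD) => [|a u sa ua0].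
  split=> [|c u w Pu Pw]; first by rewrite !mul0mx addr0.
  by rewrite !mulmxDl -!scalemxAl Pu Pw scalerDr addrACA.
move: v; apply: (weight_ind specD) => [|b v sb vb0].
  split=> [|c v w Pv Pw]; first by rewrite !(linear0, mul0mx, mulmx0) ?addr0.
  rewrite ad_is_linear mulmxDl -scalemxAl !mulmxDr -!scalemxAr mulmxDl -scalemxAl.
  by rewrite Pv Pw ad_is_linear mulmxDr -scalemxAr scalerDr addrACA.
rewrite (q_at a u) // (q_at b v) // linearZ /= -scalemxAr -scalemxAl -scalerDl.
have uv0: (u *m ad B v) *m horner_mx D (('X - (a + b)%:P) ^+ (n.+1 + n.+1)) = 0.
  rewrite -iter_horner_mx; apply: derivation_bracket_weight => //.
    by rewrite iter_horner_mx.
  by rewrite iter_horner_mx.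
have [sab | s'ab] := boolP (a + b \in s).
  by rewrite -phiD // /Q; apply: horner_mx_congr uv0 (q_phi _ sab).
suff -> : u *m ad B v = 0 by rewrite mul0mx scaler0.
case: specD => _ _ D0.
have co_ab : coprimep (('X - (a + b)%:P) ^+ (n.+1 + n.+1))
                      (\prod_(c <- s) ('X - c%:P) ^+ n.+1).
  exact: coprimep_XsubC_exp_prod.
by apply: coprime_annihilator co_ab uv0 _; rewrite D0 mulmx0.
Qed.

End Replica.

Lemma common_denominator m (d : 'I_m -> rat) :
  exists (k : int) (e : 'I_m -> int), k != 0 /\ forall i, d i * k%:~R = (e i)%:~R.
Proof.
exists (\prod_j denq (d j)), (fun i => numq (d i) * \prod_(j | j != i) denq (d j)).
split=> [|i]; first by apply/prodf_neq0 => j _; apply: denq_neq0.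
by rewrite (bigD1 i) //= !rmorphM /= mulrA -numqE.
Qed.

Section IntegralRelations.
Variables (K : fieldType) (m : nat) (lam : 'I_m -> K).
Hypothesis charK0 : [pchar K] =i pred0.

(** Additive relations with integer coefficients among the [lam i]. *)
Definition relation (c : 'I_m -> int) := \sum_i lam i *~ c i = 0.

Lemma mulrz_eq0_pchar0 (x : K) (k : int) : x *~ k = 0 -> x = 0 \/ k = 0.
Proof.
have nat0 j : x *+ j = 0 -> x = 0 \/ j = 0%N.
  move/eqP; rewrite -mulr_natr mulf_eq0 => /orP[/eqP|]; first by left.
  by rewrite (pcharf0P K).1 // => /eqP; right.
case: k => j; first by case/nat0 => ->; [left | right].
rewrite NegzE mulrNz => /eqP; rewrite oppr_eq0 => /eqP/nat0[|//].
by left.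
Qed.

Definition relation_row (c : 'I_m -> int) : 'rV[rat]_m := \row_i (c i)%:~R.

Definition relation_rows r (G : 'M[rat]_(r, m)) :=
  forall i, exists2 c, relation c & row i G = relation_row c.

(** The integer relations lie in the row space of finitely many of them: take a
family of relations of maximal rank. *)
Lemma relation_space : exists (r : nat) (G : 'M[rat]_(r, m)),
  relation_rows G /\ forall c, relation c -> (relation_row c <= G)%MS.
Proof.
suff: forall k r (G : 'M[rat]_(r, m)), (m - \rank G < k)%N -> relation_rows G ->
    exists (r : nat) (G : 'M[rat]_(r, m)),
      relation_rows G /\ forall c, relation c -> (relation_row c <= G)%MS.
  by move/(_ m.+1 0%N 0); apply; [rewrite mxrank0 subn0 | case].
elim=> // k IHk r G rkG relG.
case: (classic (forall c, relation c -> (relation_row c <= G)%MS)) => [maxG|].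
  by exists r, G.
move=> nmax; have [c nc] := not_all_ex_not _ _ nmax.
have [relc /negP cG] := imply_to_and _ _ nc.
have relG' : relation_rows (col_mx G (relation_row c)).
  move=> i; case: (splitP i) => j Dj.
    have -> : i = lshift 1 j by apply: val_inj.
    by rewrite rowKu.
  have -> : i = rshift r j by apply: val_inj.
  by rewrite rowKd; exists c => //; apply/rowP=> x; rewrite !mxE.
apply: (IHk _ _ _ relG').
have ltG : (\rank G < \rank (col_mx G (relation_row c)))%N.
  apply: rank_ltmx; rewrite ltmxE col_mx_sub (negPf cG) andbF andbT.
  by have := submx_refl (col_mx G (relation_row c)); rewrite col_mx_sub => /andP[].
rewrite -ltnS; apply: leq_trans rkG; rewrite ltnS; apply: ltn_sub2l => //.
by apply: leq_trans ltG _; apply: rank_leq_col.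
Qed.

(** If some [lam i] is nonzero then the relations span a proper rational subspace,
since otherwise a nonzero multiple of [lam i] would vanish.  So a nonzero vector
is orthogonal to all of them, and it can be scaled to have integer entries. *)
Lemma orthogonal_relations : (exists i, lam i != 0) ->
  exists2 phi : 'I_m -> int, exists i, phi i != 0 &
    forall c, relation c -> \sum_i c i * phi i = 0.
Proof.
case=> i0 lam0; have [r [G [relG maxG]]] := relation_space.
have /fin_all_exists2[c relc Dc] := relG.
have kG : kermx G^T != 0.
  apply: contraNneq lam0 => /eqP; rewrite kermx_eq0 -row_leq_rank mxrank_tr => full_G.
  have dG : ((delta_mx 0 i0 : 'rV[rat]_m) <= G)%MS.
    by rewrite submx_full // /row_full eqn_leq rank_leq_col.
  have [d Dd] := submxP dG.
  have [k [e [k0 De]]] := common_denominator (d 0).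
  suff: lam i0 *~ k = 0 by case/mulrz_eq0_pchar0 => [-> | /eqP/idPn[]].
  have Ei i : k *+ (i == i0) = \sum_j e j * c j i.
    apply: (@intr_inj rat); have /(congr1 (fun v : 'rV_m => k%:~R * v 0 i)) := Dd.
    rewrite !mxE eqxx mulr_natr rmorphMn => -> /=; rewrite mulr_sumr rmorph_sum.
    apply: eq_bigr => j _; rewrite rmorphM /= -De -mulrA mulrCA; congr (_ * (_ * _)).
    by have /rowP/(_ i) := Dc j; rewrite !mxE.
  have -> : lam i0 *~ k = \sum_i lam i *~ (k *+ (i == i0)).
    rewrite (bigD1 i0) //= eqxx big1 ?addr0 // => i /negPf->.
    by rewrite mulr0n mulr0z.
  under eq_bigr do rewrite Ei mulrz_sumr.
  rewrite exchange_big big1 //= => j _.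
  under eq_bigr do rewrite mulrC mulrzA.
  by rewrite -mulrz_suml (relc j) mul0rz.
have [v vG v0] := rowV0Pn kG; have {}vG := sub_kermxP vG.
have [k [phi [k0 Dphi]]] := common_denominator (v 0).
exists phi.
  apply: NNPP => no; case/eqP: v0; apply/rowP => i; rewrite mxE.
  have ph0 : phi i = 0 by apply: NNPP => /eqP ph0; case: no; exists i.
  have: v 0 i * k%:~R == 0 by rewrite Dphi ph0.
  by rewrite mulf_eq0 intr_eq0 (negPf k0) orbF => /eqP.
move=> b relb; apply: (@intr_inj rat); have [d Dd] := submxP (maxG b relb).
have: (relation_row b *m v^T) 0 0 * k%:~R = 0.
  by rewrite Dd -mulmxA -[G]trmxK -trmx_mul vG trmx0 mulmx0 mxE mul0r.
rewrite mxE mulr_suml => E0; rewrite rmorph_sum -[RHS]E0; apply: eq_bigr => i _.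
by rewrite rmorphM /= -Dphi !mxE mulrA.
Qed.
End IntegralRelations.

(** * The criterion of Cartan *)

Lemma spectrum_nilpotent (K : fieldType) n (X : 'M[K]_n.+1) s :
  spectrum X s -> (forall a, a \in s -> a = 0) -> X ^+ n.+1 = 0.
Proof.
case=> Us _ X0 s0; case: s => [|a [|b s]] in Us X0 s0.
- move: X0; rewrite big_nil rmorph1 => X0.
  by rewrite -[LHS]mul1r X0 mul0r.
- move: X0; rewrite big_seq1 (s0 a) ?mem_head // subr0 rmorphXn /= horner_mx_X.
  by [].
have a0 : a = 0 by apply: s0; rewrite mem_head.
have b0 : b = 0 by apply: s0; rewrite inE mem_head orbT.
by move: Us; rewrite a0 b0 /= mem_head.
Qed.

(** Suppose some eigenvalue is nonzero and take an integer function phi on the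
spectrum, orthogonal to all additive relations.  In particular phi is additive,
so q(X) with q = phi on the spectrum is a derivation, and the hypothesis reads
sum_a phi(a) r_a a = 0 with r_a > 0 the multiplicities.  This is again an additive
relation, so orthogonality gives sum_a r_a phi(a)^2 = 0, hence phi = 0. *)
Lemma cartan_replica (K : fieldType) n (B : 'M[K]_(n.+1, n.+1 * n.+1))
    (X : 'M[K]_n.+1) s : [pchar K] =i pred0 -> derivation B X -> spectrum X s ->
    (forall q, derivation B (horner_mx X q) -> \tr (horner_mx X q *m X) = 0) ->
  X ^+ n.+1 = 0.
Proof.
move=> charK0 derX specX trX; apply: (spectrum_nilpotent specX) => a sa.
apply: NNPP => a0; have [Us eigs _] := specX.
pose m := size s; pose lam (i : 'I_m) := s`_i.
have lam_onto b : b \in s -> exists i, b = lam i.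
  move=> sb; have lt_b : (index b s < m)%N by rewrite index_mem.
  by exists (Ordinal lt_b); rewrite /lam /= nth_index.
have slam i : lam i \in s by rewrite mem_nth.
have [|phi [j phij0] phi_rel] := orthogonal_relations (lam := lam) charK0.
  by have [i Di] := lam_onto a sa; exists i; rewrite -Di; apply/eqP.
pose phiK b : K := if insub (index b s) is Some i then (phi i)%:~R else 0.
have phiKE i : phiK (lam i) = (phi i)%:~R.
  by rewrite /phiK /lam index_uniq // valK.
have [q q_phi] := crt_poly (n.+1 + n.+1) phiK Us.
have qE i : q.[lam i] = (phi i)%:~R.
  have: 'X - (lam i)%:P %| q - (phiK (lam i))%:P.
    by apply: dvdp_trans (q_phi _ (slam i)); rewrite dvdp_exp // addnS.
  by rewrite dvdp_XsubCl rootE hornerD hornerN hornerC subr_eq0 phiKE => /eqP.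
have derq : derivation B (horner_mx X q).
  apply: replica_derivation q_phi => // b c /lam_onto[i ->] /lam_onto[k ->].
  case/lam_onto=> l Dl; rewrite Dl !phiKE -rmorphD /=; congr _%:~R.
  pose d (i x : 'I_m) : int := (x == i)%:R.
  have sumd (f : 'I_m -> int) x : \sum_y d x y * f y = f x.
    rewrite (bigD1 x) //= /d eqxx mul1r big1 ?addr0 // => y /negPf->.
    by rewrite mul0r.
  have sumlam x : \sum_y lam y *~ d x y = lam x.
    rewrite (bigD1 x) //= /d eqxx mulr1z big1 ?addr0 // => y /negPf->.
    by rewrite mulr0z.
  have := phi_rel (fun x => d i x + d k x - d l x).
  under eq_bigr do rewrite mulrBl mulrDl.
  rewrite sumrB big_split /= !sumd => rel; apply/esym/eqP; rewrite -subr_eq0.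
  apply/eqP/rel; rewrite /relation.
  under eq_bigr do rewrite mulrzBr mulrzDr.
  by rewrite sumrB big_split /= !sumlam Dl subrr.
have [r [r_gt0 trE]] := trace_horner specX.
have := trX q derq; rewrite -{2}[X]horner_mx_X -horner_mx_mul trE.
rewrite (big_nth 0) big_mkord => tr0.
have: \sum_(i < m) (phi i * (r (lam i))%:R) * phi i = 0.
  apply: phi_rel; rewrite /relation -[RHS]tr0; apply: eq_bigr => i _.
  by rewrite hornerM hornerX qE -/(lam i) mulrzA natz -pmulrn mulrzl.
move/eqP; rewrite psumr_eq0 => [/allP/(_ j (mem_index_enum _))/=|i _]; last first.
  by rewrite mulrAC mulr_ge0 ?ler0n // -expr2 sqr_ge0.
rewrite !mulf_eq0 (negPf phij0) orbF /= pnatr_eq0 => /eqP rj0.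
by have := r_gt0 _ (slam j); rewrite rj0.
Qed.

Lemma cartan_nilpotent (F : fieldType) n (B : 'M[F]_(n.+1, n.+1 * n.+1)) u :
    [pchar F] =i pred0 -> lie_table B ->
    (forall (K : fieldType) (f : {rmorphism F -> K}) D,
       derivation (map_mx f B) D -> \tr (D *m map_mx f (ad B u)) = 0) ->
  ad B u ^+ n.+1 = 0.
Proof.
move=> charF0 lieB tr0; have [K [f [s specX]]] := spectrum_extension (ad B u).
apply: (map_mx_inj (f := f)); rewrite map_mx0 rmorphXn /=.
apply: (cartan_replica (B := map_mx f B) _ _ specX) => [p||q /tr0 //].
  by rewrite (fmorph_pchar f) charF0.
by rewrite map_ad; apply/derivation_ad/lie_table_map.
Qed.

(** * Engel theorem and the Killing form *)

Section Lie.
Variables (F : fieldType) (n : nat) (B : 'M[F]_(n, n * n)).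
Hypothesis lieB : lie_table B.
Implicit Types (u v w : 'rV[F]_n) (U : 'M[F]_n) (P Q : 'rV[F]_n -> Prop).

Lemma bracket_ad v u w :
  v *m ad B u *m ad B w = v *m ad B w *m ad B u + v *m ad B (u *m ad B w).
Proof. by case: lieB => _ ->; rewrite mulmxBr !mulmxA addrC subrK. Qed.

Lemma bracketC u v : u *m ad B v = - (v *m ad B u).
Proof. by case: lieB. Qed.

Hypothesis charF0 : [pchar F] =i pred0.

Lemma bracketxx u : u *m ad B u = 0.
Proof.
have /eqP := bracketC u u; rewrite -subr_eq0 opprK -mulr2n -scaler_nat scaler_eq0.
by rewrite (pcharf0P F).1 // => /eqP.
Qed.

Definition bracket_closed U :=
  forall u v, (u <= U)%MS -> (v <= U)%MS -> (u *m ad B v <= U)%MS.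

Definition ad_nilpotent u := exists m, forall v, iter m (mulmx^~ (ad B u)) v = 0.

(** The pair P, Q stands for the module Q / P.  Take a proper subalgebra A of U of
maximal dimension.  The statement for A acting on U / A provides b that
normalizes A, so U = A + F b by maximality.  The statement for A on Q / P gives
vectors killed by A modulo P; b preserves those, and being nilpotent it kills
one of them modulo P. *)
Lemma engel U P Q : bracket_closed U ->
    (forall u, (u <= U)%MS -> ad_nilpotent u) -> closed_lin P -> closed_lin Q ->
    (forall u v, (u <= U)%MS -> P v -> P (v *m ad B u)) ->
    (forall u v, (u <= U)%MS -> Q v -> Q (v *m ad B u)) ->
    (exists2 v, Q v & ~ P v) ->
  exists q, [/\ Q q, ~ P q & forall u, (u <= U)%MS -> P (q *m ad B u)].
Proof.
have [k] := ubnP (\rank U); elim: k => // k IHk in U P Q *; rewrite ltnS => rkU.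
move=> subU nilU linP linQ stabP stabQ [q0 Qq0 nPq0].
have [U0 | U_neq0] := eqVneq U 0.
  exists q0; split=> // u; rewrite U0 submx0 => /eqP->.
  by rewrite linear0 mulmx0; case: linP.
pose proper (A : 'M[F]_n) := (A < U)%MS /\ bracket_closed A.
have [|A [ltAU subA] maxA] := @ex_max_rank _ _ proper 0.
  split=> [|u v]; first by rewrite lt0mx.
  by rewrite !submx0 => /eqP-> _; rewrite mul0mx.
have [leAU nleUA] := andP ltAU.
have rkA : (\rank A < k)%N by apply: leq_trans rkU; apply: rank_ltmx.
have nilA u : (u <= A)%MS -> ad_nilpotent u.
  by move=> uA; apply: nilU; apply: submx_trans leAU.
have [b [bU nbA bA]] :
    exists b : 'rV[F]_n, [/\ (b <= U)%MS, ~ (b <= A)%MS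
      & forall u, (u <= A)%MS -> (b *m ad B u <= A)%MS].
  apply: (IHk A (fun v => (v <= A)%MS) (fun v => (v <= U)%MS)) => //;
    try exact: submx_closed_lin.
  - by move=> u v uA vA; apply: subA.
  - by move=> u v uA vU; apply: subU => //; apply: submx_trans leAU.
  by have [i nAi] := row_subPn nleUA; exists (row i U); rewrite ?row_sub //; apply/negP.
have in_Ab u : (u <= A + b)%MS -> exists w c, (w <= A)%MS /\ u = w + c *: b.
  case/sub_addsmxP=> -[d e] /= ->; exists (d *m A), (e 0 0).
  by rewrite submxMl [e]mx11_scalar mul_scalar_mx !mxE.
have DU u : (u <= U)%MS -> exists w c, (w <= A)%MS /\ u = w + c *: b.
  move=> uU; apply: (in_Ab); apply: contraT => nuAb.
  have: proper (A + b)%MS.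
    split; first rewrite ltmxE addsmx_sub leAU bU /=.
      by apply: contra nuAb; apply: submx_trans.
    move=> _ _ /in_Ab[w [c [wA ->]]] /in_Ab[w' [c' [w'A ->]]].
    apply: submx_trans (addsmxSl A b).
    rewrite linearD linearZ /= mulmxDl !mulmxDr -!scalemxAl -!scalemxAr bracketxx !scaler0 addr0.
    have wbA : (w *m ad B b <= A)%MS by rewrite bracketC eqmx_opp bA.
    by rewrite !addmx_sub ?scalemx_sub //; [apply: subA | apply: bA].
  move/maxA; rewrite leqNgt => /negP[]; apply: rank_ltmx.
  by rewrite ltmxE addsmxSl addsmx_sub submx_refl; apply/negP.
have [m nil_b] := nilU b bU.
pose Q' v := Q v /\ forall u, (u <= A)%MS -> P (v *m ad B u).
have [q1 [Qq1 nPq1 q1A]] :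
    exists q, [/\ Q q, ~ P q & forall u, (u <= A)%MS -> P (q *m ad B u)].
  apply: (IHk A P Q) => //; last by exists q0.
  - by move=> u v uA; apply: stabP; apply: submx_trans leAU.
  - by move=> u v uA; apply: stabQ; apply: submx_trans leAU.
pose it j := iter j (mulmx^~ (ad B b)) q1.
have Q'it j : Q' (it j).
  elim: j => [|j [Qj Aj]]; first by split.
  split=> [|u uA] /=; first exact: stabQ.
  rewrite bracket_ad; apply: closed_linD (Aj _ (bA u uA)) => //.
  by apply: stabP => //; apply: Aj.
have [j [nPj Pj]] : exists j, ~ P (it j) /\ P (it j.+1).
  have Pm : P (it m) by rewrite /it nil_b; case: linP.
  elim: m Pm {nil_b} => [|m IHm] Pm; first by case: nPq1.
  by case: (classic (P (it m))) => [/IHm | nPm]; last by exists m.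
have [Qj Aj] := Q'it j; exists (it j); split=> // u /DU[w [c [wA ->]]].
rewrite linearD linearZ /= mulmxDr -scalemxAr.
by apply: closed_linD => //; [apply: Aj | apply: closed_linZ].
Qed.

Definition no_abelian_ideal := forall P, closed_lin P ->
  (forall u v, P u -> P (u *m ad B v)) -> (forall u v, P u -> P v -> u *m ad B v = 0) ->
  forall u, P u -> u = 0.

(** A proper subspace is killed by a nonzero form kappa(-, z).  If it contains all
brackets, invariance forces [b, z] = 0 for all b, so ad z = 0 and then z = 0. *)
Lemma perfect_of_nondegenerate P : nondegenerate B -> closed_lin P ->
  (forall u v, P (u *m ad B v)) -> forall u, P u.
Proof.
move=> ndB linP brP u; have [A PA] := closed_lin_mx linP.
suff full_A : row_full A by apply/PA; rewrite submx_full.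
rewrite -sub1mx submxE mul1mx -trmx_eq0; apply: contraT => kA.
have [v /submxP[d Dv] v0] := rowV0Pn kA.
have vA u' : (u' <= A)%MS -> u' *m v^T = 0.
  case/submxP=> e ->; rewrite Dv trmx_mul trmxK mulmxA.
  by rewrite -[_ *m A *m _]mulmxA mulmx_coker mulmx0 mul0mx.
have := ndB; rewrite nondegenerate_gram => unitG; pose z := v *m invmx (gram B).
have zP u' : P u' -> killing B u' z = 0.
  move/PA/vA=> u'v; rewrite killingC killing_gram mulmxKV //.
  by rewrite -[v *m _]trmxK trmx_mul trmxK u'v trmx0 mxE.
have bz (b : 'rV_n) : b *m ad B z = 0.
  rewrite bracketC; apply/eqP; rewrite oppr_eq0; apply/eqP/ndB => a.
  by rewrite killing_invariant // killingC; apply: zP; apply: brP.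
have az : ad B z = 0 by apply/row_matrixP => i; rewrite rowE bz row0.
have z0 : z = 0 by apply: ndB => w; rewrite /killing az mul0mx linear0.
by case/eqP: v0; rewrite -[v](mulmxKV unitG) -/z z0 mul0mx.
Qed.

Definition killing_radical u := forall v, killing B u v = 0.

Lemma closed_lin_killing_radical : closed_lin killing_radical.
Proof.
split=> [v|c u v ku kv w]; first exact: killing0l.
by rewrite killing_linearl ku kv mulr0 addr0.
Qed.

Lemma killing_radical_ideal u v : killing_radical u -> killing_radical (u *m ad B v).
Proof. by move=> ku w; rewrite killing_invariant. Qed.

(** The span of the brackets [a, b] with b in the Killing radical. *)
Definition radical_brackets u := forall P, closed_lin P ->
  (forall a b, killing_radical b -> P (a *m ad B b)) -> P u.

Lemma closed_lin_radical_brackets : closed_lin radical_brackets.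
Proof.
split=> [P linP _|c u v Pu Pv P linP PB]; first by case: linP.
by case: (linP) => _; apply; [apply: Pu | apply: Pv].
Qed.

Lemma radical_brackets_sub u : radical_brackets u -> killing_radical u.
Proof.
apply; first exact: closed_lin_killing_radical.
move=> a b kb; rewrite bracketC; apply: closed_linN closed_lin_killing_radical _.
exact: killing_radical_ideal.
Qed.

Lemma radical_brackets_ideal u v : radical_brackets u -> radical_brackets (u *m ad B v).
Proof.
move=> Ju; suff kk a b : killing_radical b -> radical_brackets (a *m ad B b).
  rewrite bracketC; apply: closed_linN closed_lin_radical_brackets _.
  by apply: kk; apply: radical_brackets_sub.
by move=> kb P _; apply.
Qed.
End Lie.

Section Semisimple.
Variables (F : fieldType) (n : nat) (B : 'M[F]_(n.+1, n.+1 * n.+1)).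
Hypothesis lieB : lie_table B.
Hypothesis charF0 : [pchar F] =i pred0.

(** For b in the Killing radical, tr (D ad [a, b]) = - kappa(a D, b) = 0, also after
an extension of scalars. *)
Lemma radical_brackets_trace u (K : fieldType) (f : {rmorphism F -> K}) D :
  radical_brackets B u -> derivation (map_mx f B) D ->
  \tr (D *m map_mx f (ad B u)) = 0.
Proof.
move=> Ju derD; apply: (Ju (fun w => \tr (D *m map_mx f (ad B w)) = 0)).
  split=> [|c v w v0 w0]; first by rewrite linear0 map_mx0 mulmx0 linear0.
  rewrite ad_is_linear map_mxD map_mxZ mulmxDr -scalemxAr mxtraceD mxtraceZ v0 w0.
  by rewrite mulr0 addr0.
move=> a b kb.
have kfb w : killing (map_mx f B) w (map_mx f b) = 0.
  move: w; apply: (closed_lin_base_change (f := f)) => [|w].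
    split=> [|c v w v0 w0]; first exact: killing0l.
    by rewrite killing_linearl v0 w0 mulr0 addr0.
  by rewrite killingC /killing -!map_ad -map_mxM trace_map_mx -/(killing B b w) kb rmorph0.
case: (lieB) => _ ->; rewrite map_mxB !map_mxM mulmxBr linearB /=.
rewrite [X in _ - X](_ : _ = \tr (map_mx f (ad B a) *m D *m map_mx f (ad B b))); last first.
  by rewrite -mulmxA [RHS]mxtrace_mulC mulmxA.
rewrite mulmxA -linearB -mulmxBl -opprB mulNmx linearN /= !map_ad -derivation_adE //.
by rewrite -/(killing _ _ _) kfb oppr0.
Qed.

Lemma radical_brackets_nilpotent u : radical_brackets B u -> ad_nilpotent B u.
Proof.
move=> Ju; exists n.+1 => v; have : ad B u ^+ n.+1 = 0.
  by apply: cartan_nilpotent => // K f D; apply: radical_brackets_trace.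
suff -> m : iter m (mulmx^~ (ad B u)) v = v *m ad B u ^+ m by move=> ->; rewrite mulmx0.
elim: m => [|m IHm] /=; first by rewrite mulmx1.
by rewrite IHm exprSr mulmxA.
Qed.

(** Let R be the Killing radical and J the span of [L, R].  By
[radical_brackets_nilpotent] the ideal J acts nilpotently, so if J were nonzero
Engel would give it a nonzero centre, an abelian ideal of L.  Thus J = 0, which
makes R itself an abelian ideal. *)
Lemma nondegenerate_of_no_abelian_ideal : no_abelian_ideal B -> nondegenerate B.
Proof.
move=> semis.
have [U UJ] := closed_lin_mx (closed_lin_radical_brackets B).
have subU : bracket_closed B U.
  by move=> u v /UJ Ju _; apply/UJ; apply: radical_brackets_ideal.
have nilU u : (u <= U)%MS -> ad_nilpotent B u.
  by move/UJ; apply: radical_brackets_nilpotent.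
have lin0 : closed_lin (fun v : 'rV[F]_n.+1 => v = 0).
  by split=> // c u v -> ->; rewrite scaler0 addr0.
have J0 u : radical_brackets B u -> u = 0.
  move=> Ju; apply: NNPP => u0.
  have [q [qU q0 Uq]] : exists q : 'rV[F]_n.+1,
      [/\ (q <= U)%MS, q <> 0 & forall w, (w <= U)%MS -> q *m ad B w = 0].
    apply: (engel lieB charF0 subU nilU lin0 (submx_closed_lin U)).
    - by move=> w v _ ->; rewrite mul0mx.
    - by move=> w v wU vU; apply: subU.
    by exists u => //; apply/UJ.
  pose Z (v : 'rV[F]_n.+1) := (v <= U)%MS /\ forall w, (w <= U)%MS -> v *m ad B w = 0.
  apply: q0; apply: (semis Z) => [|v w [vU v0]|v w [vU v0] [wU _]|//].
  - split=> [|c v w [vU v0] [wU w0]]; first by split=> [|w _]; rewrite ?sub0mx ?mul0mx.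
    split=> [|x xU]; first by rewrite addmx_sub ?scalemx_sub.
    by rewrite mulmxDl -scalemxAl v0 // w0 // scaler0 addr0.
  - split=> [|x xU]; first by apply/UJ; apply: radical_brackets_ideal => //; apply/UJ.
    rewrite bracket_ad // v0 // mul0mx add0r v0 //.
    by rewrite bracketC // eqmx_opp; apply/UJ; apply: radical_brackets_ideal => //; apply/UJ.
  exact: v0.
move=> u ku; apply: (semis (killing_radical B)) => //.
- exact: closed_lin_killing_radical.
- by move=> v w; apply: killing_radical_ideal.
by move=> v w kv kw; apply: J0 => P _; apply.
Qed.
End Semisimple.

(** * Rank one *)

Lemma injective_escapes (T : eqType) (g : nat -> T) (s : seq T) :
  injective g -> exists k, g k \notin s.
Proof.
move=> injg; apply: NNPP => no.
have: (size (map g (iota 0 (size s).+1)) <= size s)%N.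
  apply: uniq_leq_size; first by rewrite (map_inj_uniq injg) iota_uniq.
  by move=> _ /mapP[k _ ->]; apply: contraT => sk; case: no; exists k.
by rewrite size_map size_iota ltnn.
Qed.

Lemma natr_inj_pchar0 (K : fieldType) : [pchar K] =i pred0 ->
  injective (fun k : nat => k%:R : K).
Proof.
move=> charK0 i j /eqP; wlog le_ij : i j / (i <= j)%N.
  by move=> W; case: (leqP i j) => [/W//|/ltnW/W E]; rewrite eq_sym => /E.
rewrite eq_sym -subr_eq0 -natrB // (pcharf0P K).1 // subn_eq0 => le_ji.
by apply/eqP; rewrite eqn_leq le_ij.
Qed.

Lemma horner_mx_eigen (K : fieldType) n (X : 'M[K]_n.+1) (v : 'rV_n.+1) a p :
  v *m X = a *: v -> v *m horner_mx X p = p.[a] *: v.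
Proof.
move=> vX; elim/poly_ind: p => [|p c IHp]; first by rewrite rmorph0 mulmx0 horner0 scale0r.
rewrite rmorphD /= horner_mx_mul horner_mx_X horner_mx_C mulmxDr mulmxA IHp.
by rewrite -scalemxAl vX mul_mx_scalar hornerMXaddC scalerA scalerDl.
Qed.

(** The induction principle says that the eigenvectors span. *)
Definition diag_spectrum (K : fieldType) n (X : 'M[K]_n.+1) (s : seq K) :=
  spectrum X s /\ forall P : 'rV[K]_n.+1 -> Prop, closed_lin P ->
    (forall a v, a \in s -> v *m X = a *: v -> P v) -> forall v, P v.

Lemma spectrum_mem (K : fieldType) n (X : 'M[K]_n.+1) s a (v : 'rV_n.+1) :
  spectrum X s -> v != 0 -> v *m X = a *: v -> a \in s.
Proof.
case=> _ _ X0 v0 vX; apply: contraNT v0 => s'a; apply/eqP.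
have := horner_mx_eigen (\prod_(b <- s) ('X - b%:P) ^+ n.+1) vX.
rewrite X0 mulmx0 horner_prod => /esym/eqP; rewrite scaler_eq0 => /orP[|/eqP//].
rewrite prodf_seq_eq0 => /hasP[b sb] /=; rewrite horner_exp hornerXsubC expf_eq0 /=.
by rewrite subr_eq0 => /eqP ab; rewrite ab sb in s'a.
Qed.

Lemma interpolation (K : fieldType) (I : eqType) (r : seq I) (g h : I -> K) :
  {in r &, injective g} -> exists p : {poly K}, forall i, i \in r -> p.[g i] = h i.
Proof.
elim: r => [|i r IHr] injg; first by exists 0.
have [|p Dp] := IHr; first by move=> j k rj rk; apply: injg; rewrite inE ?rj ?rk orbT.
have [ri | r'i] := boolP (i \in r).
  by exists p => j; rewrite inE => /predU1P[->|]; apply: Dp.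
pose q := \prod_(j <- r) ('X - (g j)%:P).
have q_i : q.[g i] != 0.
  rewrite horner_prod prodf_seq_neq0; apply/allP => j rj /=.
  rewrite hornerXsubC subr_eq0; apply: contraNneq r'i => gij.
  by rewrite (injg i j) ?inE ?eqxx ?rj ?orbT.
exists (p + ((h i - p.[g i]) / q.[g i]) *: q) => j; rewrite inE hornerD hornerZ.
case/predU1P => [-> | rj]; first by rewrite divfK // addrC subrK.
have -> : q.[g j] = 0 by rewrite horner_prod (big_rem j) //= hornerXsubC subrr mul0r.
by rewrite mulr0 addr0 Dp.
Qed.

(** Compose the induction principle for X with the spectral projection of Y for
each eigenvalue; the projection commutes with X. *)
Lemma joint_eigen_ind (K : fieldType) n (X Y : 'M[K]_n.+1) s t (P : 'rV[K]_n.+1 -> Prop) :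
    diag_spectrum X s -> diag_spectrum Y t -> X *m Y = Y *m X -> closed_lin P ->
    (forall a b v, a \in s -> b \in t -> v *m X = a *: v -> v *m Y = b *: v -> P v) ->
  forall v, P v.
Proof.
move=> [specX indX] [specY indY] XY linP PXY.
apply: (indY) => // b u tb uY; have [Ut _ _] := specY.
have [e De] := crt_poly 1 (fun c => (c == b)%:R) Ut.
have e_at c : c \in t -> e.[c] = (c == b)%:R.
  move/De; rewrite expr1 dvdp_XsubCl rootE hornerD hornerN hornerC subr_eq0.
  by move/eqP.
pose E := horner_mx Y e.
have EY (v : 'rV[K]_n.+1) : v *m E *m Y = b *: (v *m E).
  move: v; apply: (indY) => [|c v tc vY].
    split=> [|c v w Pv Pw]; first by rewrite !mul0mx scaler0.
    by rewrite !mulmxDl -!scalemxAl Pv Pw scalerDr scalerA mulrC -scalerA.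
  rewrite /E (horner_mx_eigen _ vY) e_at // -scalemxAl vY.
  by case: eqVneq => [->|_]; rewrite ?scale1r // !scale0r scaler0.
have EX : E *m X = X *m E.
  exact: comm_horner_mx.
have PE (v : 'rV[K]_n.+1) : P (v *m E).
  move: v; apply: (indX) => [|a v sa vX].
    split=> [|c v w]; rewrite ?mul0mx; case: linP => // _ Plin.
    by rewrite mulmxDl -scalemxAl; apply: Plin.
  by apply: (PXY a b) => //; rewrite -mulmxA EX mulmxA vX scalemxAl.
by have := PE u; rewrite /E (horner_mx_eigen _ uY) e_at // eqxx scale1r.
Qed.

Section RankOne.
Variables (F : fieldType) (n : nat) (B : 'M[F]_(n.+1, n.+1 * n.+1)).
Hypotheses (lieB : lie_table B) (charF0 : [pchar F] =i pred0).
Hypothesis ndB : nondegenerate B.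

(** The one consequence of dual atomism that enters the structure theory; see
[quotient_polynomially_closed]. *)
Definition polynomially_closed (K : fieldType) m (C : 'M[K]_(m.+1, m.+1 * m.+1)) x :=
  forall y p, ad C y = horner_mx (ad C x) p -> (y <= x)%MS.

(** The pairs (y, p) with ad y = p(ad x) and deg p bounded form the kernel of a
matrix with entries in F, and kernels commute with extension of scalars. *)
Lemma polynomially_closed_map (K : fieldType) (f : {rmorphism F -> K}) x :
  polynomially_closed B x -> polynomially_closed (map_mx f B) (map_mx f x).
Proof.
move=> clx y p Dy; pose d := size p.
pose G := col_mx B (powers_mx (ad B x) d).
have Gx : (lsubmx (kermx G) <= x)%MS.
  apply/row_subP => i; set r := row i (kermx G).
  have -> : row i (lsubmx (kermx G)) = lsubmx r by apply/rowP=> j; rewrite !mxE.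
  have rG : r *m G = 0 by rewrite -row_mul mulmx_ker row0.
  apply: (clx _ (rVpoly (- rsubmx r))); rewrite horner_rVpoly /ad.
  congr vec_mx; move: rG; rewrite -{1}[r]hsubmxK mul_row_col => /eqP.
  by rewrite addr_eq0 mulNmx => /eqP.
have Gf : map_mx f G = col_mx (map_mx f B) (powers_mx (ad (map_mx f B) (map_mx f x)) d).
  by rewrite map_col_mx map_powers_mx map_ad.
have: (row_mx y (- poly_rV p : 'rV_d) <= kermx (map_mx f G))%MS.
  apply/sub_kermxP; rewrite Gf mul_row_col mulNmx; apply/eqP; rewrite subr_eq0.
  by rewrite -(can_eq vec_mxK) -horner_rVpoly poly_rV_K // -Dy.
rewrite -map_kermx => /submxP[w Dw].
rewrite -[y](row_mxKl y (- poly_rV p : 'rV_d)) Dw -mulmx_lsub -map_lsubmx.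
by apply: submx_trans (submxMl _ _) _; rewrite map_submx.
Qed.

Hypothesis clB : forall x, polynomially_closed B x.

Lemma anisotropic_neq0 x : killing B x x != 0 -> ad B x ^+ n.+1 != 0.
Proof.
apply: contraNneq => x0; apply/eqP/(@mxtrace_nilpotent _ _ _ n.+1).
by rewrite exprMn_comm ?x0 ?mul0r.
Qed.

(** The semisimple part of ad x is a derivation, hence ad z for some z; it is also a
polynomial in ad x, so z is a multiple of x.  As ad x is not nilpotent, the
semisimple part is ad x itself. *)
Lemma anisotropic_diag x (K : fieldType) (f : {rmorphism F -> K}) s :
    killing B x x != 0 -> spectrum (ad (map_mx f B) (map_mx f x)) s ->
  diag_spectrum (ad (map_mx f B) (map_mx f x)) s.
Proof.
move=> kx specX; split=> // P linP Peig; set X := ad _ _ in specX Peig.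
have [Us eigs X0] := specX.
have [q q_id] := crt_poly (n.+1 + n.+1) id Us.
have liefB := lie_table_map f lieB.
have derq : derivation (map_mx f B) (horner_mx X q).
  by apply: (replica_derivation (derivation_ad liefB (map_mx f x)) specX _ q_id).
have [z Dz] := derivation_inner liefB (nondegenerate_map (f := f) ndB) derq.
have [c Dc] : exists c, z = c *: map_mx f x.
  by apply/sub_rVP; apply: (polynomially_closed_map (@clB x) (esym Dz)).
have q_at a (v : 'rV[K]_n.+1) : a \in s -> v *m horner_mx X (('X - a%:P) ^+ n.+1) = 0 ->
    v *m horner_mx X q = a *: v.
  move=> sa va0; apply: (horner_mx_congr va0).
  by apply: dvdp_trans (q_id a sa); rewrite dvdp_exp2l // leq_addr.
have {Dz}Dq : horner_mx X q = c *: X by rewrite Dz Dc linearZ.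
have [a sa a0] : exists2 a, a \in s & a != 0.
  apply: NNPP => no; have /eqP[] := anisotropic_neq0 kx.
  apply: (map_mx_inj (f := f)); rewrite map_mx0 rmorphXn /= map_ad.
  apply: (spectrum_nilpotent specX) => a sa; apply: NNPP => a0; case: no.
  by exists a => //; apply/eqP.
have c1 : c = 1.
  have /eigenvalueP[v vX v0] := eigs a sa.
  have := horner_mx_eigen q vX; rewrite Dq -scalemxAr vX scalerA => /eqP.
  rewrite -subr_eq0 -scalerBl scaler_eq0 (negPf v0) orbF subr_eq0.
  have: 'X - a%:P %| q - a%:P by apply: dvdp_trans (q_id a sa); rewrite dvdp_exp // addnS.
  rewrite dvdp_XsubCl rootE hornerD hornerN hornerC subr_eq0 => /eqP->.
  by rewrite -{2}[a]mul1r => /eqP/(mulIf a0).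
apply: (weight_ind specX) => // a' v sa' va'; apply: (Peig a') => //.
by rewrite -(q_at a') // Dq c1 scale1r.
Qed.

(** Over a field that splits both, ad x and ad y are simultaneously diagonalizable.
For a suitable integer m the pairs of eigenvalues are separated by a + m b, so
ad y is a polynomial in ad w with w = x + m y; then y is a multiple of w. *)
Lemma anisotropic_commuting x y : killing B x x != 0 -> killing B y y != 0 ->
  x *m ad B y = 0 -> (x <= y)%MS.
Proof.
move=> kx ky xy0.
have [K1 [f1 [s1 specX1]]] := spectrum_extension (ad B x).
have [K [f2 [t]]] := spectrum_extension (map_mx f1 (ad B y)).
have /= := spectrum_map f2 specX1; move: (map f2 s1) => s.
rewrite -!map_mx_comp !map_ad; set f : {rmorphism F -> K} := f2 \o f1 => specX specY.
have diagX := anisotropic_diag kx specX; have diagY := anisotropic_diag ky specY.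
set X := ad _ _ in specX diagX; set Y := ad _ _ in specY diagY.
have charK0 : [pchar K] =i pred0 by move=> p; rewrite (fmorph_pchar f) charF0.
have [m sep] : exists m : nat,
    {in allpairs pair s t &, injective (fun ab : K * K => ab.1 + m%:R * ab.2)}.
  (* the values of m for which two distinct pairs of eigenvalues collide *)
  pose bad := [seq (u.1.1 - u.2.1) / (u.2.2 - u.1.2)
              | u <- allpairs pair (allpairs pair s t) (allpairs pair s t)].
  have [m badm] := injective_escapes bad (natr_inj_pchar0 charK0).
  exists m => u v ru rv /eqP; rewrite addrC -subr_eq => /eqP Em.
  have [E2 | N2] := eqVneq u.2 v.2.
    move: Em; rewrite E2; rewrite [u]surjective_pairing [v]surjective_pairing /=.
    by rewrite E2 addrAC subrr add0r => ->.
  case/negP: badm; apply/mapP; exists (u, v); first by apply/allpairsP; exists (u, v).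
  apply/(canRL (mulfK _)); first by rewrite /= subr_eq0 eq_sym.
  by rewrite /= mulrBr -Em; ring.
have [p Dp] := interpolation (fun ab : K * K => ab.2) sep.
pose w := x + m%:R *: y.
have Dw : ad (map_mx f B) (map_mx f w) = X + m%:R *: Y.
  by rewrite /w map_mxD map_mxZ rmorph_nat linearD linearZ.
have XY : X *m Y = Y *m X.
  apply/eqP; rewrite -subr_eq0 /X /Y; have [_ jac] := lieB.
  by rewrite -!map_ad -!map_mxM -map_mxB -jac xy0 linear0 map_mx0.
have DY : Y = horner_mx (ad (map_mx f B) (map_mx f w)) p.
  apply/row_matrixP => i; rewrite !rowE; move: (delta_mx _ _) => v.
  move: v; apply: (joint_eigen_ind diagX diagY XY) => [|a b v sa tb vX vY].
    split=> [|c u v Pu Pv]; first by rewrite !mul0mx.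
    by rewrite !mulmxDl -!scalemxAl Pu Pv.
  have vW : v *m (X + m%:R *: Y) = (a + m%:R * b) *: v.
    by rewrite mulmxDr -scalemxAr vX vY scalerDl scalerA.
  rewrite Dw (horner_mx_eigen _ vW) (Dp (a, b)) //.
  by apply/allpairsP; exists (a, b).
have /sub_rVP[c Dy] : (y <= w)%MS.
  by rewrite -(map_submx f); apply: (polynomially_closed_map (@clB w) DY).
have c0 : c != 0.
  by apply: contraNneq ky => c0; rewrite Dy c0 scale0r killing0l.
apply/sub_rVP; exists (c^-1 - m%:R); rewrite scalerBl; apply/eqP.
by rewrite eq_sym subr_eq -/w {1}Dy scalerA mulVf ?scale1r.
Qed.
(** Let E be the set of v that commute with x and are orthogonal to it.  By
[anisotropic_commuting] every v in E is isotropic, so kappa vanishes on E.  Since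
ad x is diagonalizable, L is spanned by the centralizer F x + E of x and the
brackets with x, which are orthogonal to that centralizer; so E lies in the
radical of kappa and is 0. *)
Lemma anisotropic_centralizer (x z : 'rV[F]_n.+1) :
  killing B x x != 0 -> z *m ad B x = 0 -> (z <= x)%MS.
Proof.
move=> kx zx0; pose E (v : 'rV[F]_n.+1) := v *m ad B x = 0 /\ killing B v x = 0.
have E_iso v : E v -> killing B v v = 0.
  case=> vx kvx; apply/eqP; apply: contraT => kv.
  have /sub_rVP[c Dx] : (x <= v)%MS.
    by apply: anisotropic_commuting; rewrite // bracketC // vx oppr0.
  by case/eqP: kx; rewrite {1}Dx killingZl kvx mulr0.
have E_polar u v : E u -> E v -> killing B u v = 0.
  move=> [ux ku] [vx kv]; have /E_iso : E (u + v).
    by split; rewrite ?mulmxDl ?killingDl ?ux ?vx ?ku ?kv addr0.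
  rewrite killingDl !killingDr !E_iso // add0r addr0 [killing B v u]killingC.
  rewrite -mulr2n -mulr_natr => /eqP.
  by rewrite mulf_eq0 (pcharf0P F).1 // orbF => /eqP.
have E0 y : E y -> y = 0.
  move=> Ey; have [K [f [s specX]]] := spectrum_extension (ad B x).
  rewrite map_ad in specX.
  have [_ indX] := anisotropic_diag kx specX.
  have liefB := lie_table_map f lieB.
  apply: (map_mx_inj (f := f)); rewrite map_mx0.
  apply: (nondegenerate_map (f := f) ndB).
  have linP := closed_lin_killingr (map_mx f B) (map_mx f y).
  apply: (indX) => // a v sa vX; have [a0 | a0] := eqVneq a 0.
    have: (v <= map_mx f (kermx (ad B x)))%MS.
      by rewrite map_kermx map_ad; apply/sub_kermxP; rewrite vX a0 scale0r.
    apply: closed_lin_sub linP _ _ => i; rewrite -map_row.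
    set r := row i _; have rx : r *m ad B x = 0 by rewrite -row_mul mulmx_ker row0.
    rewrite /killing -!map_ad -map_mxM trace_map_mx -/(killing B y r).
    pose c := killing B r x / killing B x x.
    have Er : E (r - c *: x).
      split; first by rewrite mulmxBl rx -scalemxAl bracketxx // scaler0 subr0.
      by rewrite -scaleNr killingDl killingZl mulNr divfK // subrr.
    rewrite -[r](subrK (c *: x)) killingDr E_polar // killingZr.
    by case: Ey => _ ->; rewrite mulr0 addr0 rmorph0.
  have -> : v = a^-1 *: (v *m ad (map_mx f B) (map_mx f x)).
    by rewrite vX scalerA mulVf // scale1r.
  rewrite killingZr killingC killing_invariant // -map_ad -map_mxM bracketC //.
  by case: Ey => -> _; rewrite oppr0 map_mx0 killing0r mulr0.
pose c := killing B z x / killing B x x.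
have /E0/eqP : E (z - c *: x).
  split; first by rewrite mulmxBl zx0 -scalemxAl bracketxx // scaler0 subr0.
  by rewrite -scaleNr killingDl killingZl mulNr divfK // subrr.
by rewrite subr_eq0 => /eqP->; rewrite scalemx_sub.
Qed.
End RankOne.

(** * The sl2-triple and the dimension *)

(** The elements a / 2^k are distinct, so they leave the finite list s. *)
Lemma half_not_in (K : fieldType) (s : seq K) a : [pchar K] =i pred0 ->
  a \in s -> a != 0 -> exists b, [/\ b \in s, b != 0 & b / 2%:R \notin s].
Proof.
move=> charK0 sa a0; have two0 : 2%:R != 0 :> K by rewrite (pcharf0P K).1.
have [k] : exists k, a / 2%:R ^+ k \notin s.
  apply: injective_escapes => i j /(mulfI a0)/invr_inj; rewrite -!natrX.
  move/(natr_inj_pchar0 charK0)/eqP; rewrite eqn_exp2l // => /eqP//.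
elim: k => [|k IHk] sk; first by rewrite expr0 divr1 sa in sk.
have [/IHk// | ] := boolP (a / 2%:R ^+ k \notin s); rewrite negbK => sk'.
exists (a / 2%:R ^+ k); split; rewrite ?mulf_neq0 ?invr_eq0 ?expf_eq0 ?(negPf two0) ?andbF //.
by rewrite -mulrA -invfM -exprSr.
Qed.

Section Sl2.
Variables (K : fieldType) (n : nat) (B : 'M[K]_(n.+1, n.+1 * n.+1)).
Hypotheses (lieB : lie_table B) (charK0 : [pchar K] =i pred0).
Hypothesis ndB : nondegenerate B.
Variables (x : 'rV[K]_n.+1) (s : seq K).
Hypothesis kx : killing B x x != 0.
Hypothesis diagX : diag_spectrum (ad B x) s.
Hypothesis centX : forall v : 'rV[K]_n.+1, v *m ad B x = 0 -> (v <= x)%MS.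

Lemma killing_eigen a b (u v : 'rV[K]_n.+1) : u *m ad B x = a *: u ->
  v *m ad B x = b *: v -> (a + b) * killing B u v = 0.
Proof.
move=> ux vx; rewrite mulrDl -[a * _]killingZl -[b * _]killingZr -ux -vx killing_invariant //.
by rewrite bracketC // -[- _]scaleN1r killingZr mulN1r addNr.
Qed.

(** The root a is chosen with a / 2 not a root.  Nondegeneracy pairs e with some
f of weight - a, and [e, f] centralizes x, so it is a multiple of x, nonzero
because kappa([e, f], x) = - a kappa(e, f). *)
Lemma sl2_triple : exists a e f, [/\ a / 2%:R \notin s, a != 0,
   e *m ad B x = a *: e, f *m ad B x = - a *: f & e *m ad B f = x].
Proof.
have [specX indX] := diagX.
have [a sa a0] : exists2 a, a \in s & a != 0.
  apply: NNPP => no; case/eqP: kx; rewrite /killing.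
  suff -> : ad B x = 0 by rewrite mul0mx linear0.
  apply/row_matrixP => i; rewrite rowE row0; move: (delta_mx _ _) => v.
  move: v; apply: indX => [|b v sb ->].
    by split=> [|c u v u0 v0]; rewrite ?mul0mx // mulmxDl -scalemxAl u0 v0 scaler0 addr0.
  have [-> | b0] := eqVneq b 0; first by rewrite scale0r.
  by case: no; exists b.
have {a sa a0} [a [sa a0 sa2]] := half_not_in charK0 sa a0.
have [_ eigs _] := specX; have /eigenvalueP[e ex e0] := eigs a sa.
have [f fx kef] : exists2 f, f *m ad B x = - a *: f & killing B e f != 0.
  apply: NNPP => no; case/eqP: e0; apply: ndB; apply: indX => [|b v sb vx].
    exact: closed_lin_killingr.
  apply: NNPP => kev; case: no; exists v; last exact/eqP.
  have /eqP := killing_eigen ex vx; rewrite mulf_eq0 addrC addr_eq0.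
  by case/orP => [/eqP<- //|/eqP/kev].
have /sub_rVP[c Dc] : (e *m ad B f <= x)%MS.
  apply: centX; rewrite bracket_ad // ex fx -scalemxAl linearZ /= -scalemxAr.
  by rewrite scaleNr addrN.
have c0 : c != 0.
  apply: contraNneq kef => c0; have := killing_invariant lieB e f x.
  rewrite Dc c0 scale0r killing0l fx killingZr => /esym/eqP.
  by rewrite mulf_eq0 oppr_eq0 (negPf a0).
exists a, e, (c^-1 *: f); split=> //; first by rewrite -scalemxAl fx !scalerA mulrC.
by rewrite linearZ /= -scalemxAr Dc scalerA mulVf // scale1r.
Qed.

(** The weights b + k c are distinct, so the images of v must eventually vanish. *)
Lemma weight_chain c (M : 'M[K]_n.+1) b (v : 'rV_n.+1) : c != 0 ->
    (forall b (u : 'rV_n.+1), u *m ad B x = b *: u -> u *m M *m ad B x = (b + c) *: (u *m M)) ->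
    v *m ad B x = b *: v -> v != 0 ->
  exists k, iter k (mulmx^~ M) v != 0 /\ iter k.+1 (mulmx^~ M) v = 0.
Proof.
move=> c0 shift vx v0; have [specX _] := diagX.
have itx k : iter k (mulmx^~ M) v *m ad B x = (b + k%:R * c) *: iter k (mulmx^~ M) v.
  elim: k => [|k IHk] /=; first by rewrite mul0r addr0.
  by rewrite (shift _ _ IHk) -addrA -[X in _ + (_ + X)]mul1r -mulrDl -natr1.
have [k] : exists k, b + k%:R * c \notin s.
  apply: injective_escapes => i j /addrI/(mulIf c0); exact: natr_inj_pchar0.
elim: k => [|k IHk] sk.
  by rewrite (spectrum_mem specX v0 (itx 0%N)) in sk.
have [it0 | it0] := eqVneq (iter k.+1 (mulmx^~ M) v) 0; last first.
  by rewrite (spectrum_mem specX it0 (itx k.+1)) in sk.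
have {}IHk : ex (fun k => iter k.+1 (mulmx^~ M) v = 0) by exists k.
clear sk it0; have [m] := IHk; elim: m => [|m IHm] itm.
  by exists 0%N.
have [itm0 | itm1] := eqVneq (iter m.+1 (mulmx^~ M) v) 0; first exact: IHm.
by exists m.+1.
Qed.

(** Let W be the orthogonal complement of the triple e, f, x; it is stable under
the triple.  A nonzero weight vector of W would yield a highest weight vector,
whose f-string has weights from m a / 2 down to - m a / 2 in steps of a.  For m
even it contains weight 0, hence a nonzero multiple of x, which is not in W; for m
odd it contains a / 2, which is not a root.  So the triple spans. *)
Lemma sl2_dimension : n.+1 = 3%N.
Proof.
have [specX indX] := diagX.
have [a [e [f [sa2 a0 ex fx ef]]]] := sl2_triple.
have two0 : 2%:R != 0 :> K by rewrite (pcharf0P K).1.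
have xx : x *m ad B x = 0 *: x by rewrite bracketxx // scale0r.
have fe : f *m ad B e = - x by rewrite bracketC // ef.
have shiftE b (u : 'rV_n.+1) : u *m ad B x = b *: u ->
    u *m ad B e *m ad B x = (b + a) *: (u *m ad B e).
  by move=> ux; rewrite bracket_ad // ux ex linearZ /= -scalemxAr -scalemxAl scalerDl.
have shiftF b (u : 'rV_n.+1) : u *m ad B x = b *: u ->
    u *m ad B f *m ad B x = (b - a) *: (u *m ad B f).
  by move=> ux; rewrite bracket_ad // ux fx linearZ /= -scalemxAr -scalemxAl scalerDl.
have kef : killing B e f != 0.
  apply: contraNneq kx => kef; rewrite -{1}ef killing_invariant // fx killingZr kef.
  by rewrite mulr0.
have kee : killing B e e = 0.
  have /eqP := killing_eigen ex ex; rewrite -mulr2n -mulr_natl !mulf_eq0.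
  by rewrite (negPf two0) (negPf a0) => /eqP.
have kff : killing B f f = 0.
  have /eqP := killing_eigen fx fx; rewrite -mulr2n -mulr_natl !mulf_eq0 oppr_eq0.
  by rewrite (negPf two0) (negPf a0) => /eqP.
have kex : killing B e x = 0.
  have /eqP := killing_eigen ex xx; rewrite addr0 mulf_eq0 (negPf a0).
  by move/eqP.
have kfx : killing B f x = 0.
  have /eqP := killing_eigen fx xx; rewrite addr0 mulf_eq0 oppr_eq0 (negPf a0).
  by move/eqP.
pose W (v : 'rV[K]_n.+1) := [/\ killing B v e = 0, killing B v f = 0 & killing B v x = 0].
have WE v : W v -> W (v *m ad B e).
  case=> ve vf vx; split; rewrite killing_invariant //.
  - by rewrite bracketxx // killing0r.
  - by rewrite ef.
  by rewrite ex killingZr ve mulr0.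
have WF v : W v -> W (v *m ad B f).
  case=> ve vf vx; split; rewrite killing_invariant //.
  - by rewrite fe -scaleN1r killingZr vx mulr0.
  - by rewrite bracketxx // killing0r.
  by rewrite fx killingZr vf mulr0.
have W0 b v : v *m ad B x = b *: v -> W v -> v = 0.
  move=> vx Wv; apply: NNPP => /eqP v0.
  have [k [vk0 vk]] := weight_chain a0 shiftE vx v0.
  pose w := iter k (mulmx^~ (ad B e)) v.
  have [c [wx Ww]] : exists c, w *m ad B x = c *: w /\ W w.
    rewrite /w; elim: (k) => [|j [c [wx Ww]]] /=; first by exists b.
    by exists (c + a); split; [apply: shiftE | apply: WE].
  have wE : w *m ad B e = 0 := vk.
  have Na0 : - a != 0 by rewrite oppr_eq0.
  have [m [wm0 wm]] := weight_chain Na0 shiftF wx vk0.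
  pose u j := iter j (mulmx^~ (ad B f)) w.
  have ux j : u j *m ad B x = (c - j%:R * a) *: u j.
    elim: j => [|j IHj]; first by rewrite mul0r subr0.
    by rewrite /= (shiftF _ _ IHj) -addrA -opprD -{2}[a]mul1r -mulrDl natr1.
  have Wu j : W (u j) by elim: j => //= j; apply: WF.
  (* the usual coefficient of the string, doubled: the normalization [e, f] = x
     makes a, rather than 2, the step between weights *)
  have uE j : 2%:R *: (u j.+1 *m ad B e) = - (j.+1%:R * (2%:R * c - a * j%:R)) *: u j.
    have step i : u i.+1 *m ad B e = u i *m ad B e *m ad B f - u i *m ad B x.
      have [_ jac] := lieB; rewrite -ef jac mulmxBr !mulmxA opprB addrC subrK.
      by [].
    elim: j => [|j IHj].
      by rewrite step /= wE mul0mx wx sub0r scalerN scalerA -scaleNr; congr (_ *: _); ring.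
    rewrite step scalerBr scalemxAl IHj ux -scalemxAl -[u j *m _]/(u j.+1).
    rewrite scalerA -scalerBl; congr (_ *: _).
    by rewrite -[j.+2]addn2 -[j.+1]addn1 !natrD; ring.
  have cE : 2%:R * c = a * m%:R.
    apply/eqP; rewrite -subr_eq0; have := uE m; rewrite [u m.+1]wm mul0mx scaler0.
    move/esym/eqP; rewrite scaler_eq0 (negPf wm0) orbF oppr_eq0 mulf_eq0.
    by rewrite (pcharf0P K).1.
  have u_neq0 j : (j <= m)%N -> u j != 0.
    move=> le_jm; apply: contraNneq wm0 => uj0.
    rewrite -/(u m) -(subnK le_jm) /u iterD -/(u j) uj0.
    by elim: (m - j)%N => //= i /eqP->; rewrite mul0mx.
  have Dm := odd_double_half m; set j := m./2 in Dm.
  have le_jm : (j <= m)%N by rewrite -Dm -addnn addnA leq_addl.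
  have cj : c - j%:R * a = (odd m)%:R * (a / 2%:R).
    apply: (mulfI two0); rewrite mulrBr cE -{1}Dm natrD -mul2n natrM.
    by field.
  have := ux j; rewrite cj; case: (odd m) => [|] uxj.
    by rewrite mul1r in uxj; rewrite (spectrum_mem specX (u_neq0 j le_jm) uxj) in sa2.
  rewrite mul0r scale0r in uxj; have /sub_rVP[d ud] := centX uxj.
  have [_ _ /eqP] := Wu j; rewrite {1}ud killingZl mulf_eq0 (negPf kx) orbF => /eqP d0.
  by have := u_neq0 j le_jm; rewrite ud d0 scale0r eqxx.
pose S : 'M[K]_(3, n.+1) := \matrix_(i < 3) (if i == 0 then e else if i == 1 then f else x).
have eS : (e <= S)%MS by have := row_sub 0 S; rewrite rowK.
have fS : (f <= S)%MS by have := row_sub 1 S; rewrite rowK.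
have xS : (x <= S)%MS by have := row_sub 2%:R S; rewrite rowK.
have fullS (v : 'rV[K]_n.+1) : (v <= S)%MS.
  move: v; apply: indX => [|b v sb vx]; first exact: submx_closed_lin.
  pose c1 := killing B v f / killing B e f.
  pose c2 := killing B v e / killing B e f.
  pose c3 := killing B v x / killing B x x.
  suff : v - (c1 *: e + c2 *: f + c3 *: x) = 0.
    by move/eqP; rewrite subr_eq0 => /eqP->; rewrite !addmx_sub ?scalemx_sub.
  apply: (W0 b); last first.
    split; rewrite -[- _]scaleN1r killingDl killingZl !killingDl !killingZl.
    - rewrite kee [killing B f e]killingC [killing B x e]killingC kex !mulr0 addr0 add0r.
      by rewrite divfK // mulN1r subrr.
    - by rewrite kff [killing B x f]killingC kfx !mulr0 !addr0 divfK // mulN1r subrr.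
    by rewrite kex kfx !mulr0 !add0r divfK // mulN1r subrr.
  rewrite mulmxBl !mulmxDl vx -!scalemxAl ex fx xx scalerBr !scalerDr !scalerA.
  have c1b : b * c1 = c1 * a.
    have /eqP := killing_eigen vx fx; rewrite mulrC mulf_eq0 subr_eq0.
    by rewrite /c1 => /orP[/eqP->|/eqP->]; rewrite ?mul0r ?mulr0 // mulrC.
  have c2b : b * c2 = c2 * - a.
    have /eqP := killing_eigen vx ex; rewrite mulrC mulf_eq0 addr_eq0.
    by rewrite /c2 => /orP[/eqP->|/eqP->]; rewrite ?mul0r ?mulr0 // mulrC.
  have c3b : b * c3 = c3 * 0.
    have /eqP := killing_eigen vx xx; rewrite mulrC mulf_eq0 addr0.
    by rewrite /c3 => /orP[/eqP->|/eqP->]; rewrite ?mul0r ?mulr0.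
  by rewrite c1b c2b c3b.
have rk_full : \rank S = n.+1.
  by apply/eqP; rewrite -[_ == _]/(row_full S) -sub1mx; apply/row_subP.
have rk_free : \rank S = 3%N.
  apply/eqP; rewrite -[_ == _]/(row_free S) -kermx_eq0; apply/rowV0P => d /sub_kermxP.
  have -> : d *m S = d 0 0 *: e + (d 0 1 *: f + d 0 2%:R *: x).
    rewrite mulmx_sum_row !big_ord_recl big_ord0 addr0 !rowK /=.
    have -> : lift ord0 ord0 = 1 :> 'I_3 by apply: val_inj.
    by have -> : lift ord0 (lift ord0 ord0) = 2%:R :> 'I_3 by apply: val_inj.
  set d0 := d 0 0; set d1 := d 0 1; set d2 := d 0 2%:R => dS.
  have key v : d0 * killing B e v + (d1 * killing B f v + d2 * killing B x v) = 0.
    by rewrite -!killingZl -!killingDl dS killing0l.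
  have z0 : d0 = 0.
    have /eqP := key f; rewrite kff [killing B x f]killingC kfx !mulr0 !addr0.
    by rewrite mulf_eq0 (negPf kef) orbF => /eqP.
  have z1 : d1 = 0.
    have /eqP := key e; rewrite kee [killing B x e]killingC kex !mulr0 addr0 add0r.
    by rewrite killingC mulf_eq0 (negPf kef) orbF => /eqP.
  have z2 : d2 = 0.
    have /eqP := key x; rewrite kex kfx !mulr0 !add0r.
    by rewrite mulf_eq0 (negPf kx) orbF => /eqP.
  apply/rowP => i; rewrite mxE.
  have : (i == 0) || (i == 1) || (i == 2%:R) by case: i => [[|[|[|]]]].
  by case/orP=> [/orP[]|] /eqP->.
by rewrite -rk_full rk_free.
Qed.
End Sl2.

Lemma anisotropic_dimension (F : fieldType) n (B : 'M[F]_(n.+1, n.+1 * n.+1)) :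
    [pchar F] =i pred0 -> lie_table B -> nondegenerate B ->
    (forall x, polynomially_closed B x) ->
  n.+1 = 3%N.
Proof.
move=> charF0 lieB ndB clB.
have [x kx] : exists x, killing B x x != 0.
  apply: NNPP => no.
  have iso x : killing B x x = 0 by apply: NNPP => /eqP kx; case: no; exists x.
  have : const_mx 1 = 0 :> 'rV[F]_n.+1.
    apply: ndB => v; have /eqP := iso (const_mx 1 + v).
    rewrite killingDl !killingDr !iso add0r addr0 [killing B v _]killingC -mulr2n.
    by rewrite -mulr_natr mulf_eq0 (pcharf0P F).1 // orbF => /eqP.
  by move/rowP/(_ 0)/eqP; rewrite !mxE oner_eq0.
have [K [f [s specX]]] := spectrum_extension (ad B x).
have specX' := specX; rewrite map_ad in specX'.
have diagX := anisotropic_diag lieB ndB clB kx specX'.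
apply: (sl2_dimension (lie_table_map f lieB) _ (nondegenerate_map (f := f) ndB) _ diagX).
- by move=> p; rewrite (fmorph_pchar f) charF0.
- by rewrite /killing -!map_ad -map_mxM trace_map_mx fmorph_eq0.
move=> v vx; have: (v <= map_mx f (kermx (ad B x)))%MS.
  by rewrite map_kermx map_ad; apply/sub_kermxP.
move/submx_trans; apply; rewrite map_submx; apply/row_subP => i.
apply: (anisotropic_centralizer lieB charF0 ndB clB kx).
by rewrite -row_mul mulmx_ker row0.
Qed.

(** * The solvable radical of a Leibniz algebra *)

Section Bracket.
Variables (F : fieldType) (L : vectType F) (br : {bilinear L -> L -> L}).
Implicit Types (U V W : {vspace L}).

Definition derived_in U k := iter k (fun V : {vspace L} => brv br V V) U.

Lemma brvS U V U' V' : (U <= U')%VS -> (V <= V')%VS -> (brv br U V <= brv br U' V')%VS.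
Proof.
move=> UU' VV'; apply/brv_sub => u v uU vV.
by apply: (iffLR (brv_sub br U' V' _) (subvv _)); apply: subvP; eauto.
Qed.

Lemma mem_brv U V u v : u \in U -> v \in V -> br u v \in brv br U V.
Proof. by move=> uU vV; apply: (iffLR (brv_sub br U V _) (subvv _)). Qed.

Lemma derived_inS U V k : (U <= V)%VS -> (derived_in U k <= derived_in V k)%VS.
Proof. by move=> UV; elim: k => //= k IHk; apply: brvS. Qed.

Definition solvable_in U := exists k, derived_in U k = 0%VS.

Lemma solvable_extension U V : solvable_in V ->
  (forall x y, x \in U -> y \in U -> br x y \in V) -> solvable_in U.
Proof.
case=> k V0 UV; exists k.+1; rewrite /derived_in iterSr; apply/eqP.
rewrite -subv0 -V0; apply: derived_inS; apply/brv_sub => x y; exact: UV.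
Qed.

Hypothesis leibnizL : right_leibniz br.

(** The quotient by R has no nonzero abelian ideal. *)
Definition no_abelian_ideal_above (R : {vspace L}) :=
  forall A, ideal br A -> (R <= A)%VS ->
    (forall x y, x \in A -> y \in A -> br x y \in R) -> A = R.

Lemma exists_radical : exists R : {vspace L},
  [/\ ideal br R, solvable_in R & no_abelian_ideal_above R].
Proof.
have [|R [idR solR] maxR] := @ex_max_dim _ _ (fun U => ideal br U /\ solvable_in U) 0%VS.
  split; last by exists 0%N.
  by move=> x y; rewrite memv0 => /eqP->; rewrite linear0l linear0r mem0v.
exists R; split=> // A idA RA abA; apply/esym/eqP; rewrite eqEdim RA.
by apply: maxR; split=> //; apply: solvable_extension solR abA.
Qed.

Section Radical.
Variable R : {vspace L}.
Hypothesis idR : ideal br R.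
Hypothesis maxR : no_abelian_ideal_above R.

(** The elements z with [L, z] = 0 form an abelian ideal Z that contains all squares,
and R + Z is abelian modulo R. *)
Lemma square_in_radical x : br x x \in R.
Proof.
have [Z ZP] : exists Z : {vspace L}, forall z, z \in Z <-> forall y, br y z = 0.
  apply: closed_lin_vspace; split=> [y|c u v u0 v0 y]; first exact: linear0r.
  by rewrite linearDr linearZr_LR u0 v0 scaler0 addr0.
have idZ : ideal br Z.
  move=> z y /ZP z0; split; apply/ZP => w; last by rewrite z0 linear0r.
  by rewrite leibnizL !z0 linear0l subrr.
suff <- : (R + Z)%VS = R.
  apply: (subvP (addvSr R Z)); apply/ZP => y; by rewrite leibnizL subrr.
apply: maxR; first last.
- move=> _ _ /memv_addP[r rR [z zZ ->]] /memv_addP[r' r'R [z' z'Z ->]].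
  rewrite linearDl !linearDr (iffLR (ZP z') z'Z) (iffLR (ZP z') z'Z).
  by rewrite !rpredD ?mem0v //; [case: (idR r' rR) | case: (idR z r'R)].
- exact: addvSl.
move=> _ y /memv_addP[r rR [z zZ ->]]; rewrite linearDl linearDr.
by have [? ?] := idR y rR; have [? ?] := idZ z y zZ; split; apply: memv_add.
Qed.

Lemma bracket_skew_radical x y : br x y + br y x \in R.
Proof.
have := square_in_radical (x + y); rewrite linearDl !linearDr.
by rewrite addrCA addrA rpredDr ?square_in_radical // addrCA rpredDl ?square_in_radical // addrC.
Qed.

(** The quotient L / R in coordinates, with a linear section of the projection. *)
Lemma quotient_coordinates m : \dim R^C = m ->
  exists (pi : L -> 'rV[F]_m) (sg : 'rV[F]_m -> L),
  [/\ linear pi, linear sg, cancel sg pi & forall u, (u \in R) = (pi u == 0)].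
Proof.
move=> <-; pose X := vbasis (R^C)%VS.
exists (fun u => \row_i coord X i (u - projv R u)),
  (fun w : 'rV_(\dim (R^C)) => \sum_(i < \dim (R^C)) w 0 i *: X`_i).
split.
- move=> c u v; apply/rowP => i; rewrite !mxE -linearP; congr (coord _ _ _).
  by rewrite linearP scalerBr opprD addrACA.
- move=> c u v; rewrite scaler_sumr -big_split; apply: eq_bigr => i _ /=.
  by rewrite !mxE scalerDl scalerA.
- move=> w; apply/rowP => i; rewrite mxE.
  set u := \sum_j _; have uC : u \in (R^C)%VS.
    by apply: memv_suml => j _; apply: rpredZ; apply: vbasis_mem; rewrite mem_nth // size_tuple.
  have -> : projv R u = 0 by apply/eqP; rewrite -memv_ker lker_proj.
  by rewrite subr0 coord_sum_free // (basis_free (vbasisP _)).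
move=> u; apply/idP/eqP => [uR | /rowP u0].
  by apply/rowP => i; rewrite !mxE projv_id // subrr linear0.
suff /eqP : u - projv R u = 0 by rewrite subr_eq0 => /eqP->; rewrite memv_proj.
rewrite (coord_vbasis (memv_projC R u)) big1 // => i _.
by have := u0 i; rewrite !mxE => ->; rewrite scale0r.
Qed.
End Radical.
End Bracket.

(** * The quotient by the radical *)

Lemma mem_of_maximal (F : fieldType) (L : vectType F) (br : L -> L -> L)
    (U : {vspace L}) y : dually_atomistic br -> subalgebra br U ->
  (forall M, maximal_subalgebra br M -> (U <= M)%VS -> y \in M) -> y \in U.
Proof.
move=> daL subU yM; have [S [maxS US]] := daL U subU.
apply/US => M SM; apply: yM; first exact: maxS.
by apply/subvP => u /US/(_ M SM).
Qed.

Section Quotient.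
Variables (F : fieldType) (L : vectType F) (br : {bilinear L -> L -> L}).
Hypotheses (charF0 : [pchar F] =i pred0) (leibnizL : right_leibniz br).
Variables (R : {vspace L}) (n : nat) (pi : L -> 'rV[F]_n.+1) (sg : 'rV[F]_n.+1 -> L).
Hypotheses (idR : ideal br R) (maxR : no_abelian_ideal_above br R).
Hypotheses (pi_lin : linear pi) (sg_lin : linear sg).
Hypotheses (sgK : cancel sg pi) (piR : forall u, (u \in R) = (pi u == 0)).

HB.instance Definition _ := GRing.isLinear.Build F L 'rV[F]_n.+1 *:%R pi pi_lin.
HB.instance Definition _ := GRing.isLinear.Build F 'rV[F]_n.+1 L *:%R sg sg_lin.

Definition quotient_table : 'M[F]_(n.+1, n.+1 * n.+1) :=
  \matrix_i mxvec (\matrix_j pi (br (sg (delta_mx 0 j)) (sg (delta_mx 0 i)))).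
Local Notation T := quotient_table.

Lemma quotient_tableE (w v : 'rV_n.+1) : w *m ad T v = pi (br (sg w) (sg v)).
Proof.
move: w; apply: closed_lin_delta => [|j].
  split=> [|c u w u0 w0]; first by rewrite mul0mx linear0 linear0l linear0.
  by rewrite mulmxDl -scalemxAl u0 w0 linearP linearDl linearZl_LR linearP.
move: v; apply: closed_lin_delta => [|i].
  split=> [|c u w u0 w0]; first by rewrite !linear0 ?mulmx0 ?linear0r ?linear0.
  by rewrite ad_is_linear mulmxDr -scalemxAr u0 w0 linearP linearDr linearZr_LR linearP.
by rewrite /ad -!rowE !rowK mxvecK rowK.
Qed.

Lemma pi_radical r : r \in R -> pi r = 0.
Proof. by rewrite piR => /eqP. Qed.

Lemma section_congr u : u - sg (pi u) \in R.
Proof. by rewrite piR linearB /= sgK subrr. Qed.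

Lemma pi_br u v : pi (br u v) = pi u *m ad T (pi v).
Proof.
rewrite quotient_tableE; apply/eqP; rewrite -subr_eq0 -linearB -piR.
have -> : br u v - br (sg (pi u)) (sg (pi v)) =
    br (u - sg (pi u)) v + br (sg (pi u)) (v - sg (pi v)).
  by rewrite linearBl linearBr addrA subrK.
by apply: rpredD; [case: (idR v (section_congr u)) | case: (idR (sg (pi u)) (section_congr v))].
Qed.

Lemma quotient_lie : lie_table T.
Proof.
split=> u v.
  apply/eqP; rewrite -addr_eq0 -[u]sgK -[v]sgK -!pi_br -linearD -piR.
  exact: (bracket_skew_radical leibnizL idR maxR).
apply/row_matrixP => i; rewrite !rowE -[delta_mx 0 i]sgK -[u]sgK -[v]sgK.
by rewrite -!pi_br leibnizL linearB /= !pi_br mulmxBr !mulmxA.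
Qed.

Lemma quotient_no_abelian_ideal : no_abelian_ideal T.
Proof.
move=> P linP idP abP.
have [A AP] : exists A : {vspace L}, forall u, u \in A <-> P (pi u).
  apply: closed_lin_vspace; case: linP => P0 Plin; split; first by rewrite linear0.
  by move=> c u v Pu Pv; rewrite linearP; apply: Plin.
have AR : A = R.
  apply: maxR => [u v /AP Pu||u v /AP Pu /AP Pv].
  - split; apply/AP; rewrite pi_br; first exact: idP.
    by rewrite bracketC; [apply: closed_linN linP _; apply: idP | apply: quotient_lie].
  - by apply/subvP => r rR; apply/AP; rewrite pi_radical //; case: linP.
  by rewrite piR pi_br abP.
move=> w Pw; rewrite -[w]sgK; apply: pi_radical; rewrite -AR.
by apply/AP; rewrite sgK.
Qed.

Lemma quotient_nondegenerate : nondegenerate T.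
Proof.
apply: nondegenerate_of_no_abelian_ideal => //; first exact: quotient_lie.
exact: quotient_no_abelian_ideal.
Qed.

Lemma perfect_mod_radical (P : L -> Prop) : closed_lin P -> (forall r, r \in R -> P r) ->
  (forall u v, P (br u v)) -> forall u, P u.
Proof.
move=> linP PR Pbr u; rewrite -[u](subrK (sg (pi u))).
apply: closed_linD => //; first by apply: PR; apply: section_congr.
apply: (perfect_of_nondegenerate quotient_lie quotient_nondegenerate
  (P := fun w => P (sg w))) => [|v w].
  case: linP => P0 Plin; split; first by rewrite linear0.
  by move=> c v w Pv Pw; rewrite linearP; apply: Plin.
rewrite quotient_tableE -[sg (pi _)](subrK (br (sg v) (sg w))) -opprB.
apply: closed_linD => //; apply: closed_linN => //.
by apply: PR; apply: section_congr.
Qed.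

Hypothesis daL : dually_atomistic br.

(** Let M be a maximal subalgebra that contains x and R.  Its right normalizer N, the
set of z with [M, z] in M, is a subalgebra by the Leibniz identity and contains M and
y.  If N = M then y is in M.  If N = L then M is an ideal modulo R and [L, L] is in
M, since L = M + F z for any z outside M; this contradicts perfectness.  So y lies
in every such M, hence in F x + R. *)
Lemma right_normalized_mem x y :
    (forall M : {vspace L}, (R <= M)%VS -> (forall m, m \in M -> br m x \in M) ->
       forall m, m \in M -> br m y \in M) ->
  y \in (<[x]> + R)%VS.
Proof.
move=> stab; apply: (mem_of_maximal daL) => [|M [subM Mneq maxM] xRM].
  move=> _ _ /memv_addP[_ /vlineP[a ->] [r rR ->]] /memv_addP[_ /vlineP[b ->] [r' r'R ->]].
  apply: (subvP (addvSr <[x]> R)); rewrite linearDl !linearDr linearZl_LR linearZr_LR.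
  have [? _] := idR (b *: x) rR; have [? _] := idR r' rR.
  have [_ ?] := idR (a *: x) r'R.
  by rewrite !rpredD ?rpredZ // (square_in_radical leibnizL idR maxR).
have xM : x \in M by apply: (subvP (subv_trans (addvSl _ _) xRM)); apply: memv_line.
have RM : (R <= M)%VS := subv_trans (addvSr _ _) xRM.
have My : forall m, m \in M -> br m y \in M by apply: stab => // m mM; apply: subM.
have [N NP] : exists N : {vspace L}, forall z, z \in N <-> forall m, m \in M -> br m z \in M.
  apply: closed_lin_vspace; split=> [m _|c u v u0 v0 m mM]; first by rewrite linear0r mem0v.
  by rewrite linearDr linearZr_LR rpredD ?rpredZ ?u0 ?v0.
have subN : subalgebra br N.
  move=> u v /NP uN /NP vN; apply/NP => m mM; rewrite leibnizL.
  by rewrite rpredB // ?vN ?uN // ?vN.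
have [] := maxM N subN; first by apply/subvP => m mM; apply/NP => m' m'M; apply: subM.
  by move=> <-; apply/NP.
move=> Nf; have {Nf NP My subN N}idM m z : m \in M -> br m z \in M.
  by move=> mM; apply: (iffLR (NP z)) => //; rewrite Nf memvf.
have zM m z : m \in M -> br z m \in M.
  move=> mM; rewrite -[br z m](addrK (br m z)) rpredB ?idM //.
  by apply: (subvP RM); apply: (bracket_skew_radical leibnizL idR maxR).
have [z nzM] : exists z, z \notin M.
  apply: NNPP => no; case: Mneq; apply/vspaceP => z; rewrite memvf.
  by apply: contraT => nz; case: no; exists z.
have Mz u v : u \in (M + <[z]>)%VS -> v \in (M + <[z]>)%VS -> br u v \in M.
  move=> /memv_addP[m mM [_ /vlineP[a ->] ->]] /memv_addP[m' m'M [_ /vlineP[b ->] ->]].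
  have zzM : br z z \in M.
    by apply: (subvP RM); apply: (square_in_radical leibnizL idR maxR).
  rewrite linearDl !linearDr !linearZl_LR !linearZr_LR.
  by do ![apply: rpredD | apply: rpredZ] => //; [apply: idM | apply: idM | apply: zM].
case: Mneq; apply/vspaceP => w; rewrite memvf; move: w.
have [||Mz_eq|Mz_full] := maxM (M + <[z]>)%VS.
- by move=> u v uMz vMz; apply: (subvP (addvSl _ _)); apply: Mz.
- exact: addvSl.
- by case/negP: nzM; rewrite -Mz_eq; apply: (subvP (addvSr _ _)); apply: memv_line.
apply: perfect_mod_radical => [|r rR|u v]; first exact: vspace_closed_lin.
  exact: (subvP RM).
by apply: Mz; rewrite Mz_full memvf.
Qed.

(** A subspace stable under ad x is stable under every polynomial in ad x. *)
Lemma quotient_polynomially_closed x : polynomially_closed T x.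
Proof.
move=> y p Dy; apply/sub_rVP.
have: sg y \in (<[sg x]> + R)%VS.
  apply: right_normalized_mem => M RM Mx m mM.
  pose Q w := exists2 m', m' \in M & w = pi m'.
  have linQ : closed_lin Q.
    split; first by exists 0; rewrite ?mem0v // linear0.
    move=> c _ _ [u uM ->] [v vM ->]; exists (c *: u + v); last by rewrite linearP.
    by rewrite rpredD ?rpredZ.
  have [m' m'M Dm'] : Q (pi m *m ad T y).
    rewrite Dy; have : Q (pi m) by exists m.
    elim/poly_ind: p {Dy} (pi m) => [|p c IHp] w Qw.
      by rewrite rmorph0 mulmx0; case: linQ.
    rewrite rmorphD /= mulrC horner_mx_mul horner_mx_X horner_mx_C mulmxDr mulmxA mul_mx_scalar.
    apply: closed_linD => //; last exact: closed_linZ.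
    apply: IHp; have [m1 m1M ->] := Qw; exists (br m1 (sg x)); first exact: Mx.
    by rewrite pi_br sgK.
  rewrite -[br m (sg y)](subrK m') rpredD //; apply: (subvP RM).
  by rewrite piR linearB /= pi_br sgK Dm' subrr.
case/memv_addP=> _ /vlineP[c ->] [r rR Dsy]; exists c.
by rewrite -[y]sgK Dsy linearD linearZ /= sgK pi_radical // addr0.
Qed.

Lemma quotient_dimension : n.+1 = 3%N.
Proof.
apply: (anisotropic_dimension charF0 quotient_lie quotient_nondegenerate).
exact: quotient_polynomially_closed.
Qed.
End Quotient.

(** * Vanishing of the radical *)

Section RadicalZero.
Variables (F : fieldType) (L : vectType F) (br : {bilinear L -> L -> L}).
Hypotheses (leibnizL : right_leibniz br) (daL : dually_atomistic br).
Variable R : {vspace L}.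
Hypotheses (idR : ideal br R) (solR : solvable_in br R).
Hypothesis sqR : forall x, br x x \in R.
Hypothesis perfectR : forall P : L -> Prop, closed_lin P -> (forall r, r \in R -> P r) ->
  (forall u v, P (br u v)) -> forall u, P u.

Lemma ideal_add_brv I : ideal br I -> ideal br (brv br R R + I)%VS.
Proof.
move=> idI; set A := (_ + _)%VS => u y.
have [Z ZP] : exists Z : {vspace L},
    forall z, z \in Z <-> forall y, br z y \in A /\ br y z \in A.
  apply: closed_lin_vspace; split=> [w|c a b a0 b0 w].
    by rewrite linear0l linear0r mem0v.
  have [? ?] := a0 w; have [? ?] := b0 w.
  by rewrite linearDl linearDr linearZl_LR linearZr_LR !rpredD ?rpredZ.
suff AZ : (A <= Z)%VS by move/(subvP AZ)/ZP.
have inA a b : a \in R -> b \in R -> br a b \in A.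
  by move=> aR bR; apply: (subvP (addvSl _ _)); apply: mem_brv.
rewrite subv_add; apply/andP; split; last first.
  apply/subvP => i iI; apply/ZP => w; have [? ?] := idI i w iI.
  by split; apply: (subvP (addvSr _ _)).
apply/brv_sub => a b aR bR; apply/ZP => w.
have [aw wa] := idR w aR; have [bw wb] := idR w bR.
split; last by rewrite leibnizL rpredB ?inA.
by rewrite -[br (br a b) w](subrK (br (br a w) b)) -leibnizL rpredD ?inA.
Qed.

(** If R = [R, R] + I then R is the sum of I and any term of its derived series. *)
Lemma solvable_brv_proper I : ideal br I -> (brv br R R + I)%VS = R -> (R <= I)%VS.
Proof.
move=> idI DR; have [k Dk] := solR.
suff: (R <= derived_in br R k + I)%VS by rewrite Dk add0v.
elim: (k) => [|j IHj]; first exact: addvSl.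
rewrite -{1}DR subv_add addvSr andbT.
apply: subv_trans (brvS br IHj IHj) _; apply/brv_sub.
move=> _ _ /memv_addP[a aD [i iI ->]] /memv_addP[b bD [i' i'I ->]].
rewrite linearDr; apply: rpredD; last first.
  by apply: (subvP (addvSr _ _)); case: (idI i' (a + i) i'I).
rewrite linearDl memv_add //; first exact: mem_brv.
by case: (idI i b iI).
Qed.

(** Assume R is nonzero and let I be a maximal ideal of L inside R, I <> R; then
[R, R] is in I.  A maximal subalgebra M that contains I but not R is a complement:
M + R = L and the intersection of M and R is I.  Hence a subalgebra between I and R
other than I lies only in maximal subalgebras that contain R, and R = I + F j.
The algebra L acts on the line R / I through scalars, and perfectness modulo R
makes them all zero.  So every complement M contains [L, L], hence there is only
one, and j is not in it.  For x in M outside I, the subalgebra I + F (x + j) is thus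
contained only in maximal subalgebras that contain j, although it does not
contain j itself. *)
Lemma radical_eq0 : R <> fullv -> R = 0%VS.
Proof.
move=> Rf; apply: NNPP => R0.
have [|I [idI IR InR] maxI] :=
    @ex_max_dim _ _ (fun I => [/\ ideal br I, (I <= R)%VS & I <> R]) 0%VS.
  split; [|exact: sub0v|by move/esym].
  by move=> x y; rewrite memv0 => /eqP->; rewrite linear0l linear0r mem0v.
have {}maxI A : ideal br A -> (I <= A)%VS -> (A <= R)%VS -> A <> R -> A = I.
  by move=> idA IA AR AnR; apply/esym/eqP; rewrite eqEdim IA maxI.
have nRI : ~~ (R <= I)%VS.
  by apply/negP => RI; case: InR; apply/eqP; rewrite eqEsubv IR.
have RR x y : x \in R -> y \in R -> br x y \in I.
  move=> xR yR; have <- : (brv br R R + I)%VS = I.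
    apply: maxI; first exact: ideal_add_brv.
    - exact: addvSr.
    - by rewrite subv_add IR andbT; apply/brv_sub => a b aR _; case: (idR b aR).
    by move/(solvable_brv_proper idI); apply/negP.
  by apply: (subvP (addvSl _ _)); apply: mem_brv.
have complement M : maximal_subalgebra br M -> (I <= M)%VS -> ~~ (R <= M)%VS ->
    (M + R)%VS = fullv /\ (M :&: R)%VS = I.
  move=> [subM Mneq maxM] IM nRM.
  have full : (M + R)%VS = fullv.
    have [||E|//] := maxM (M + R)%VS; last 1 first.
    - by case/negP: nRM; rewrite -E addvSr.
    - move=> _ _ /memv_addP[a aM [r rR ->]] /memv_addP[b bM [r' r'R ->]].
      rewrite linearDr; apply: rpredD; last first.
        by apply: (subvP (addvSr _ _)); case: (idR (a + r) r'R).
      by rewrite linearDl memv_add ?subM //; case: (idR b rR).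
    exact: addvSl.
  split=> //; apply: maxI; last 1 first.
  - by move=> E; case/negP: nRM; rewrite -E capvSl.
  - move=> u y /memv_capP[uM uR]; have : y \in (M + R)%VS by rewrite full memvf.
    case/memv_addP=> m mM [r rR ->].
    have [? ?] := idR (m + r) uR.
    split; apply/memv_capP; split=> //.
      by rewrite linearDr; apply: rpredD; [apply: subM | apply: (subvP IM); apply: RR].
    by rewrite linearDl; apply: rpredD; [apply: subM | apply: (subvP IM); apply: RR].
  - by rewrite subv_cap IM.
  exact: capvSr.
have [j jR jI] : exists2 j, j \in R & j \notin I.
  by have [j] := subvPn nRI; exists j.
have subI u : (forall a b, a \in (I + <[u]>)%VS -> b \in (I + <[u]>)%VS -> br a b \in I) ->
    subalgebra br (I + <[u]>)%VS.
  by move=> uI a b aT bT; apply: (subvP (addvSl _ _)); apply: uI.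
have RIj : (R <= I + <[j]>)%VS.
  apply/subvP => r rR; apply: (mem_of_maximal daL) => [a b|M maxM IjM].
    have TR : (I + <[j]> <= R)%VS by rewrite subv_add IR.
    by move=> aT bT; apply: (subvP (addvSl _ _)); apply: RR; apply: (subvP TR).
  apply: contraT => rM; have nRM : ~~ (R <= M)%VS.
    by apply: contra rM => /subvP->.
  have [_ MI] := complement M maxM (subv_trans (addvSl _ _) IjM) nRM.
  case/negP: jI; rewrite -MI; apply/memv_capP; split=> //.
  by apply: (subvP (subv_trans (addvSr _ _) IjM)); apply: memv_line.
have jy y : br j y \in I.
  move: y; apply: perfectR => [|r rR|u v].
  - split=> [|c u v u0 v0]; first by rewrite linear0r mem0v.
    by rewrite linearDr linearZr_LR rpredD ?rpredZ.
  - exact: RR.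
  have scal w : exists c, exists2 i, i \in I & br j w = i + c *: j.
    have [jwR _] := idR w jR; have /memv_addP[i iI [_ /vlineP[c ->] E]] := subvP RIj _ jwR.
    by exists c, i.
  have [c [i iI ju]] := scal u; have [d [i' i'I jv]] := scal v.
  have E1 : br (br j u) v = (br i v + c *: i') + (c * d) *: j.
    by rewrite ju linearDl linearZl_LR jv scalerDr scalerA addrA.
  have E2 : br (br j v) u = (br i' u + d *: i) + (c * d) *: j.
    by rewrite jv linearDl linearZl_LR ju scalerDr scalerA addrA [d * c]mulrC.
  rewrite leibnizL E1 E2 opprD addrACA subrr addr0.
  have [? _] := idI i v iI; have [? _] := idI i' u i'I.
  by rewrite rpredB ?rpredD ?rpredZ.
have yj y : br y j \in I.
  apply: contraT => yjI; have swap a b c : br a (br b c) = - br a (br c b).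
    by rewrite !leibnizL opprB.
  have [_ yjR] := idR y jR; have /memv_addP[i iI [_ /vlineP[c ->] E]] := subvP RIj _ yjR.
  have c0 : c != 0 by apply: contraNneq yjI => c0; rewrite E c0 scale0r addr0.
  have : br y (br y j) \in I.
    by rewrite swap rpredN; case: (idI _ y (jy y)).
  rewrite E linearDr linearZr_LR rpredDl; last by case: (idI i y iI).
  by move/(rpredZ c^-1); rewrite scalerA mulVf // scale1r (negPf yjI).
have Ry r y : r \in R -> br r y \in I /\ br y r \in I.
  move=> rR; have /memv_addP[i iI [_ /vlineP[c ->] ->]] := subvP RIj _ rR.
  have [? ?] := idI i y iI.
  by rewrite linearDl linearDr linearZl_LR linearZr_LR !rpredD ?rpredZ ?jy ?yj.
have br_in M u v : maximal_subalgebra br M -> (I <= M)%VS -> ~~ (R <= M)%VS -> br u v \in M.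
  move=> maxM IM nRM; have [full _] := complement M maxM IM nRM; have [subM _ _] := maxM.
  have /memv_addP[a aM [r rR ->]] : u \in (M + R)%VS by rewrite full memvf.
  have /memv_addP[b bM [r' r'R ->]] : v \in (M + R)%VS by rewrite full memvf.
  have [? _] := Ry r b rR; have [_ ?] := Ry r' (a + r) r'R.
  rewrite linearDr; apply: rpredD; last exact: (subvP IM).
  by rewrite linearDl; apply: rpredD; [apply: subM | apply: (subvP IM)].
have [M [maxM IM nRM]] : exists M, [/\ maximal_subalgebra br M, (I <= M)%VS & ~~ (R <= M)%VS].
  apply: NNPP => no; case/negP: jI; apply: (mem_of_maximal daL) => [a b aI _|M maxM IM].
    by case: (idI a b aI).
  by apply: contraT => jM; case: no; exists M; split=> //; apply: contra jM => /subvP->.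
have [full MRI] := complement M maxM IM nRM.
have [x xM xI] : exists2 x, x \in M & x \notin I.
  apply: NNPP => no; have MI : (M <= I)%VS.
    by apply/subvP => x xM; apply: contraT => xI; case: no; exists x.
  case: Rf; rewrite -full; apply/esym/eqP.
  by rewrite eqEsubv addvSr subv_add subvv (subv_trans MI IR).
have jM : j \notin M by apply: contra jI => jM; rewrite -MRI; apply/memv_capP.
have sqI : br (x + j) (x + j) \in I.
  have xx : br x x \in I.
    rewrite -MRI; apply/memv_capP; split; last exact: sqR.
    by case: maxM => subM _ _; apply: subM.
  by rewrite linearDl !linearDr !rpredD ?jy ?yj.
have : j \in (I + <[x + j]>)%VS.
  apply: (mem_of_maximal daL) => [|N maxN IN].
    apply: subI => // _ _ /memv_addP[a aI [_ /vlineP[c ->] ->]]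
                          /memv_addP[b bI [_ /vlineP[d ->] ->]].
    have [? _] := idI a (b + d *: (x + j)) aI; have [_ ?] := idI b (c *: (x + j)) bI.
    by rewrite linearDl rpredD // linearDr rpredD // linearZl_LR linearZr_LR !rpredZ ?sqI.
  have IN' : (I <= N)%VS := subv_trans (addvSl _ _) IN.
  apply: contraT => jN; have nRN : ~~ (R <= N)%VS by apply: contra jN => /subvP->.
  have MN : (M <= N)%VS.
    (* both contain the brackets, which together with R span L *)
    apply/subvP => m mM; have [c [p [pN pM Dm]]] :
        exists c p, [/\ p \in N, p \in M & m = p + c *: j].
      move: {mM} m; apply: perfectR => [|r rR|u v].
      - split=> [|c u v [d [p [pN pM ->]]] [d' [p' [pN' pM' ->]]]].
          by exists 0, 0; rewrite !mem0v scale0r addr0.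
        exists (c * d + d'), (c *: p + p'); rewrite !rpredD ?rpredZ //; split=> //.
        by rewrite scalerDr scalerA scalerDl addrACA.
      - have /memv_addP[i iI [_ /vlineP[c ->] ->]] := subvP RIj _ rR.
        by exists c, i; rewrite (subvP IN') ?(subvP IM).
      by exists 0, (br u v); rewrite !br_in // scale0r addr0.
    suff c0 : c = 0 by rewrite Dm c0 scale0r addr0.
    apply: contraNeq jM => c0; rewrite -[j](scalerK c0) rpredZ //.
    by rewrite -(rpredDl _ pM) // -Dm.
  have [subN Nneq _] := maxN; have [_ _ maxM'] := maxM.
  have [NM|//] := maxM' N subN MN.
  case/negP: jM; rewrite -NM -(rpredDl _ (subvP MN x xM)).
  by apply: (subvP (subv_trans (addvSr _ _) IN)); apply: memv_line.
case/memv_addP=> i iI [_ /vlineP[c ->] Dj].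
have c0 : c != 0.
  by apply: contraNneq jI => c0; rewrite Dj c0 scale0r addr0.
case/negP: xI; rewrite -MRI; apply/memv_capP; split=> //.
have iR : i \in R := subvP IR i iI.
rewrite -(rpredDr _ jR) -[_ + j](scalerK c0) rpredZ //.
by rewrite -(rpredDl _ iR) -Dj.
Qed.
End RadicalZero.

(** * Simplicity and non-splitness *)

Section Final.
Variables (F : fieldType) (L : vectType F) (br : {bilinear L -> L -> L}).

(** With a, b spanning I, the ideal [I, I] is spanned by [a, b], hence abelian; so it
is 0, and I is abelian. *)
Lemma small_ideal_eq0 (I : {vspace L}) : right_leibniz br -> (forall x, br x x = 0) ->
  no_abelian_ideal_above br 0%VS -> ideal br I -> (\dim I <= 2)%N -> I = 0%VS.
Proof.
move=> leibnizL sq0 max0 idI dimI.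
have idz : ideal br 0%VS.
  by move=> x y; rewrite memv0 => /eqP->; rewrite linear0l linear0r mem0v.
have [a [b DI]] : exists a b, I = (<[a]> + <[b]>)%VS.
  have := span_basis (vbasisP I); have := size_tuple (vbasis I).
  case: (tval (vbasis I)) => [|a [|b [|c s]]] /= sz <-.
  - by exists 0, 0; rewrite span_nil addvv; apply/esym/eqP; rewrite -dimv_eq0 dim_vline eqxx.
  - by exists a, a; rewrite span_seq1 addvv.
  - by exists a, b; rewrite span_cons span_seq1.
  by rewrite -sz in dimI.
have ba : br b a = - br a b.
  apply/eqP; rewrite -addr_eq0; have := sq0 (b + a).
  by rewrite linearDl !linearDr !sq0 add0r addr0 => ->.
have brI x y : x \in I -> y \in I -> br x y \in <[br a b]>%VS.
  rewrite DI => /memv_addP[_ /vlineP[c ->] [_ /vlineP[d ->] ->]].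
  case/memv_addP=> [_ /vlineP[c' ->] [_ /vlineP[d' ->] ->]].
  rewrite linearDl !linearDr !linearZl_LR !linearZr_LR !sq0 ba !scaler0 addr0 add0r.
  by rewrite !scalerN rpredD ?rpredN ?rpredZ ?memv_line.
have idK : ideal br (brv br I I) by have := ideal_add_brv leibnizL idI idz; rewrite addv0.
have K0 : brv br I I = 0%VS.
  apply: max0 => // [|x y xK yK]; first exact: sub0v.
  have KI : (brv br I I <= <[br a b]>)%VS by apply/brv_sub.
  have /vlineP[c ->] := subvP KI x xK; have /vlineP[d ->] := subvP KI y yK.
  by rewrite linearZl_LR linearZr_LR sq0 !scaler0 mem0v.
by apply: max0 => // [|x y xI yI]; rewrite ?sub0v // -K0 mem_brv.
Qed.

(** Let e, h, k be the standard basis.  A maximal subalgebra that contains e is not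
the line of e, which lies in the plane of e and h; and any y in it outside that line
produces h, as [e, y] is a combination of h and e.  So the line of e is not an
intersection of maximal subalgebras. *)
Lemma split_not_dually_atomistic : [pchar F] =i pred0 ->
  isomorphic_algebras br (@sl2_br F) -> ~ dually_atomistic br.
Proof.
move=> charF0 [f [[f' fK f'K] f_br]] daL.
pose g x := vsval (f x).
have g_lin : linear g by move=> c x y; rewrite /g !linearP.
have g_inj x y : g x = g y -> x = y by move=> /val_inj/(can_inj fK).
have g_br x y : g (br x y) = g x *m g y - g y *m g x by rewrite /g f_br.
have g_tr x : \tr (g x) = 0 by apply/eqP; rewrite -mem_sl2 subvsP.
have g_onto A : \tr A = 0 -> exists x, g x = A.
  move=> /eqP; rewrite -mem_sl2 => trA; exists (f' (Subvs trA)).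
  by rewrite /g f'K.
have gD x y : g (x + y) = g x + g y by rewrite -[x]scale1r g_lin !scale1r.
have g0 : g 0 = 0 by apply: (addrI (g 0)); rewrite -gD !addr0.
have gZ c x : g (c *: x) = c *: g x by rewrite -[_ *: x]addr0 g_lin g0 addr0.
pose mE : 'M[F]_2 := delta_mx 0 1; pose mF : 'M[F]_2 := delta_mx 1 0.
pose mH : 'M[F]_2 := delta_mx 0 0 - delta_mx 1 1.
have tr2 (A : 'M[F]_2) : \tr A = A 0 0 + A 1 1.
  by rewrite /mxtrace !big_ord_recl big_ord0 addr0; congr (_ + A _ _); apply: val_inj.
have mx2 (A C : 'M[F]_2) : A 0 0 = C 0 0 -> A 0 1 = C 0 1 -> A 1 0 = C 1 0 ->
    A 1 1 = C 1 1 -> A = C.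
  move=> e00 e01 e10 e11; apply/matrixP => i j.
  have ord2 (k : 'I_2) : k = 0 \/ k = 1.
    by case: k => [[|[|k]] //= lt_k]; [left | right]; apply: val_inj.
  by case: (ord2 i) => ->; case: (ord2 j) => ->.
have [|e ge] := g_onto mE; first by rewrite tr2 !mxE /= addr0.
have [|h gh] := g_onto mH; first by rewrite tr2 !mxE /= subr0 add0r subrr.
have [|k gk] := g_onto mF; first by rewrite tr2 !mxE /= addr0.
have mul2 (A C : 'M[F]_2) i j : (A *m C) i j = A i 0 * C 0 j + A i 1 * C 1 j.
  by rewrite mxE !big_ord_recl big_ord0 addr0; congr (_ + A _ _ * C _ _); apply: val_inj.
have subE (A C : 'M[F]_2) i j : (A - C) i j = A i j - C i j by rewrite !mxE.
have addE (A C : 'M[F]_2) i j : (A + C) i j = A i j + C i j by rewrite !mxE.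
have scaleE c (A : 'M[F]_2) i j : (c *: A) i j = c * A i j by rewrite !mxE.
have coords y : y = g y 0 1 *: e + g y 0 0 *: h + g y 1 0 *: k.
  have tr_y : g y 1 1 = - g y 0 0.
    by apply/eqP; rewrite -addr_eq0 addrC -tr2 g_tr.
  apply: g_inj; rewrite !gD !gZ ge gh gk.
  apply: mx2; rewrite ?tr_y !mxE /=; ring.
have ad_e y : br e y = g y 1 0 *: h + (g y 1 1 - g y 0 0) *: e.
  apply: g_inj; rewrite g_br gD !gZ ge gh.
  by apply: mx2; rewrite !(subE, addE, scaleE, mul2) !mxE /=; ring.
have ee : br e e = 0 by rewrite ad_e ge !mxE /= scale0r subrr scale0r addr0.
have subFe : subalgebra br <[e]>%VS.
  move=> _ _ /vlineP[c ->] /vlineP[d ->].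
  by rewrite linearZl_LR linearZr_LR ee !scaler0 mem0v.
have h_e : h \notin <[e]>%VS.
  apply/negP => /vlineP[c Dh]; have := gh; rewrite Dh gZ ge => /matrixP/(_ 0 0).
  by rewrite !mxE /= mulr0 subr0 => /esym/eqP; rewrite oner_eq0.
case/negP: (h_e); apply: (mem_of_maximal daL) => // M [subM Mneq maxM] eM.
have {}eM : e \in M by apply: (subvP eM); apply: memv_line.
have h_of y : y \in M -> y \notin <[e]>%VS -> h \in M.
  move=> yM ye; have : br e y \in M by apply: subM.
  rewrite ad_e rpredDr; last exact: rpredZ.
  move=> yhM.
  have [y10 | y10] := eqVneq (g y 1 0) 0; last first.
    by rewrite -[h](scalerK y10) rpredZ.
  have Dy := coords y; rewrite y10 scale0r addr0 in Dy.
  have y00 : g y 0 0 != 0.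
    by apply: contraNneq ye => y00; rewrite Dy y00 scale0r addr0 rpredZ ?memv_line.
  rewrite -[h](scalerK y00) rpredZ // -[_ *: h](addKr (g y 0 1 *: e)) -Dy.
  by rewrite rpredD ?rpredN ?rpredZ.
have [[y yM ye]|Me] := classic (exists2 y, y \in M & y \notin <[e]>%VS); first exact: h_of ye.
have {Me}Me : M = <[e]>%VS.
  apply/eqP; rewrite eqEsubv -memvE eM andbT; apply/subvP => y yM.
  by apply: contraT => ye; case: Me; exists y.
(* the line of e is not maximal: it lies in the plane of e and h *)
have eh : br e h = - 2%:R *: e.
  by rewrite ad_e gh !mxE /= subr0 scale0r add0r; congr (_ *: _); ring.
have he : br h e = 2%:R *: e.
  apply: g_inj; rewrite g_br gZ ge gh.
  by apply: mx2; rewrite !(subE, addE, scaleE, mul2) !mxE /=; ring.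
have hh : br h h = 0 by apply: g_inj; rewrite g_br subrr g0.
have sub_eh : subalgebra br (<[e]> + <[h]>)%VS.
  move=> _ _ /memv_addP[_ /vlineP[a ->] [_ /vlineP[b ->] ->]]
             /memv_addP[_ /vlineP[c ->] [_ /vlineP[d ->] ->]].
  apply: (subvP (addvSl _ _)); rewrite linearDl !linearDr !linearZl_LR !linearZr_LR.
  by rewrite ee eh he hh !scaler0 !rpredD ?mem0v ?rpredZ ?memv_line.
have [|E|full] := maxM _ sub_eh; first by rewrite Me addvSl.
  by rewrite -E; apply: (subvP (addvSr _ _)); apply: memv_line.
have : k \in (<[e]> + <[h]>)%VS by rewrite full memvf.
case/memv_addP=> _ /vlineP[c ->] [_ /vlineP[d ->] Dk].
have := gk; rewrite Dk gD !gZ ge gh => /matrixP/(_ 1 0); rewrite !mxE /=.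
by rewrite !mulr0 subrr mulr0 addr0 => /esym/eqP; rewrite oner_eq0.
Qed.
End Final.

Theorem proposition3p3 (F : fieldType) (charF0 : [pchar F] =i pred0)
    (L : vectType F) (br : {bilinear L -> L -> L})
    (leibnizL : right_leibniz br) (daL : dually_atomistic br) :
  nonsplit_simple_lie3 br \/ solvable_algebra br.
Proof.
have [R [idR solR maxR]] := exists_radical br.
have [Rf | Rf] := eqVneq R fullv; first by right; rewrite Rf in solR.
left; have dimC : (0 < \dim R^C)%N.
  rewrite dimv_compl subn_gt0 ltn_neqAle dimvS ?subvf // andbT.
  by apply: contraNneq Rf => dR; rewrite eqEdim subvf dR leqnn.
case Dn : (\dim R^C) dimC => [//|n] _.
have [pi [sg [pi_lin sg_lin sgK piR]]] := quotient_coordinates Dn.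
have sqR := square_in_radical leibnizL idR maxR.
have perfectR := perfect_mod_radical charF0 leibnizL idR maxR pi_lin sg_lin sgK piR.
have dim3 := quotient_dimension charF0 leibnizL idR maxR pi_lin sg_lin sgK piR daL.
have R0 := radical_eq0 leibnizL daL idR solR sqR perfectR (elimN eqP Rf).
subst R.
have dimL : \dim {:L} = 3%N by rewrite -dim3 -Dn dimv_compl dimv0 subn0.
have sq0 x : br x x = 0 by apply/eqP; rewrite -memv0.
have skew x y : br y x = - br x y.
  apply/eqP; rewrite -addr_eq0; have := sq0 (y + x).
  by rewrite linearDl !linearDr !sq0 add0r addr0 => ->.
split=> //; last first.
  by move=> iso; apply: (split_not_dually_atomistic charF0 iso daL).
split.
- split=> // x y z; rewrite leibnizL (skew (br z x) y) (skew (br x y) z) (skew x z).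
  by rewrite linearNl opprK subrK subrr.
- apply: NNPP => ab; case/eqP: Rf; apply/esym/maxR; rewrite ?sub0v // => x y.
    by rewrite !memvf.
  move=> _ _; rewrite memv0; apply/eqP; apply: NNPP => xy; case: ab; exists x, y; exact: xy.
move=> I idI; have [If | If] := eqVneq I fullv; [by right | left].
apply: small_ideal_eq0 => //; rewrite -ltnS -dimL ltn_neqAle dimvS ?subvf // andbT.
by apply: contraNneq If => dI; rewrite eqEdim subvf dI leqnn.
Qed.
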